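(* Let $G$ be a finite simple graph that is $(P_3\cup P_2,K_4)$-free and also free of the co-domino and the co-A. Let $D_1=\{x\in V(G): \omega(G-N(x))\le 2\}$ and $D_2=V(G)\setminus D_1$. If $G[D_2]$ is not isomorphic to an induced subgraph of $K_3$, then $\chi(G)\le 7$.
   Context: $P_n$ is the path on $n$ vertices, $K_n$ the complete graph on $n$ vertices, $\cup$ disjoint union; ''free'' refers to induced subgraphs. $N(x)$ is the open neighborhood of $x$ and $G-N(x)$ the subgraph induced by $V(G)\setminus N(x)$; $\omega$ is the clique number and $\chi$ the chromatic number. Let $C=u_1v_1v_2v_3u_3u_2$ be a $6$-cycle (edges $u_1v_1, v_1v_2, v_2v_3, v_3u_3, u_3u_2, u_2u_1$). The co-domino is obtained from $C$ by adding edges $v_1v_3$ and $u_1u_3$; the co-A is obtained from $C$ by adding edges $v_1v_3$, $u_1u_3$ and $u_1v_3$. *)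

(* Defs.v *)
(* Finite simple graphs: a finType T with a symmetric,
   irreflexive adjacency relation e : rel T. *)
From mathcomp Require Import all_boot.
Set Implicit Arguments. Unset Strict Implicit. Unset Printing Implicit Defensive.

Definition induced_in (T : finType) (e : rel T) (k : nat) (h : rel 'I_k) : Prop :=
  exists f : 'I_k -> T, injective f /\ forall i j, e (f i) (f j) = h i j.

Definition free (T : finType) (e : rel T) (k : nat) (h : rel 'I_k) : Prop :=
  ~ induced_in e h.

Definition graph_of (k : nat) (E : seq (nat * nat)) : rel 'I_k :=
  fun i j => ((val i, val j) \in E) || ((val j, val i) \in E).

Definition P3uP2 : rel 'I_5 := @graph_of 5 [:: (0,1); (1,2); (3,4)].
Definition K4 : rel 'I_4 := fun i j => i != j.
(* C = u1 v1 v2 v3 u3 u2 with labels u1=0, v1=1, v2=2, v3=3, u3=4, u2=5 *)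
Definition C6_edges : seq (nat * nat) := [:: (0,1); (1,2); (2,3); (3,4); (4,5); (5,0)].
Definition co_domino : rel 'I_6 := @graph_of 6 (C6_edges ++ [:: (1,3); (0,4)]).
Definition co_A : rel 'I_6 := @graph_of 6 (C6_edges ++ [:: (1,3); (0,4); (0,3)]).

Definition nbhd (T : finType) (e : rel T) (x : T) : {set T} := [set y | e x y].

Definition is_clique (T : finType) (e : rel T) (Q : {set T}) : bool :=
  [forall x in Q, forall y in Q, (x != y) ==> e x y].

Definition omega_of (T : finType) (e : rel T) (S : {set T}) : nat :=
  \max_(Q : {set T} | (Q \subset S) && is_clique e Q) #|Q|.

Definition D1 (T : finType) (e : rel T) : {set T} :=
  [set x | omega_of e (~: nbhd e x) <= 2].
Definition D2 (T : finType) (e : rel T) : {set T} := ~: D1 e.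

Definition induced_iso_sub_K3 (T : finType) (e : rel T) (S : {set T}) : Prop :=
  exists g : T -> 'I_3, {in S &, injective g} /\
    {in S &, forall x y, e x y = (g x != g y)}.

Definition colorable (T : finType) (e : rel T) (k : nat) : Prop :=
  exists c : T -> 'I_k, forall x y, e x y -> c x != c y.

(* Main.v *)
(* If a triangle has an anticomplete edge, its common neighbourhoods give three
   stable sets, the vertices with exactly one neighbour on it form a fourth,
   and the vertices with none form disjoint cliques, hence seven colours.
   Otherwise the vertices anticomplete to an edge induce a matching.  If no
   non-isolated vertex misses a triangle, take a vertex [a] and an edge [mn]
   among its non-neighbours: [mn] splits N(a) into three stable sets and the
   non-neighbours of [a] into two stable sets and a matching.

   There remains a non-isolated vertex [x] missing a triangle [abc].  If
   deleting some neighbour [z] leaves N(x) bipartite, then (for an edge [uz]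
   in N(x)) 2 colours suffice for N(x) - z, 2 for [z] and the vertices
   anticomplete to [xz], 2 for those anticomplete to [xu] and 1 for
   N(u) /\ N(z).  So N(x) - z contains a 5-cycle for every [z].  Up to
   symmetry there are only three ways in which such a 5-cycle (together with
   a neighbour of [x] outside it having a single neighbour on the triangle)
   attaches to [abc].  Three stable sets cover the vertices with two
   neighbours in [abc]; the others get four colours by a finite case analysis:
   vertices are classified by their adjacency to the configuration, two
   vertices of equal colour would be the ends of an edge completing a forbidden
   subgraph, and if the classes cannot be coloured one branches on whether a
   given class is inhabited, enlarging the configuration if it is. *)
Require Import Defs.
From mathcomp Require Import all_boot.
From Stdlib Require Import NArith.
Set Implicit Arguments. Unset Strict Implicit. Unset Printing Implicit Defensive.

(** * Colourings *)

Section Colouring.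
Variables (T : finType) (e : rel T).
Hypotheses (e_sym : symmetric e) (e_irr : irreflexive e).

(** Colours are plain numbers bounded only on [S], so that palettes can be shifted and merged
    without casts between ordinals. *)
Definition col (k : nat) (S : {set T}) :=
  exists c : T -> nat, (forall v, v \in S -> c v < k) /\
    forall u v, u \in S -> v \in S -> e u v -> c u != c v.

Lemma col_sub k (A B : {set T}) : A \subset B -> col k B -> col k A.
Proof.
move=> /subsetP sAB [c [c_lt cP]]; exists c; split=> [v /sAB/c_lt //|u v uA vA].
by apply: cP; apply: sAB.
Qed.

Lemma col_leq k l S : k <= l -> col k S -> col l S.
Proof.
move=> le_kl [c [c_lt cP]]; exists c; split=> // v vS.
exact: leq_trans (c_lt v vS) le_kl.
Qed.

Lemma colU k l (A B : {set T}) : col k A -> col l B -> col (k + l) (A :|: B).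
Proof.
move=> [c [c_lt cP]] [d [d_lt dP]].
exists (fun v => if v \in A then c v else k + d v); split=> [v|u v].
  rewrite inE; case: ifP => [vA _|_ /= vB]; first exact: ltn_addr (c_lt v vA).
  by rewrite ltn_add2l d_lt.
rewrite !inE; case: ifP => uA; case: ifP => vA //= uB vB uv.
- exact: cP.
- by apply/eqP => E; have := c_lt u uA; rewrite E ltnNge leq_addr.
- by apply/eqP => E; have := c_lt v vA; rewrite -E ltnNge leq_addr.
- by rewrite eqn_add2l dP.
Qed.

Lemma col_stable (A : {set T}) :
  (forall u v, u \in A -> v \in A -> ~~ e u v) -> col 1 A.
Proof.
by move=> st; exists (fun=> 0); split=> // u v uA vA; rewrite (negPf (st u v uA vA)).
Qed.

Lemma col_isolated k (S : {set T}) y :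
  0 < k -> (forall v, v \in S -> ~~ e y v) -> col k S -> col k (y |: S).
Proof.
move=> k0 iso [c [c_lt cP]].
exists (fun v => if v \in S then c v else 0); split=> [v _|u v].
  by case: ifP => // /c_lt.
rewrite !inE; case: ifP => uS; case: ifP => vS; rewrite ?orbF ?orbT.
- by move=> _ _; apply: cP.
- by move=> _ /eqP->; rewrite e_sym (negPf (iso u uS)).
- by move=> /eqP-> _; rewrite (negPf (iso v vS)).
- by move=> /eqP-> /eqP->; rewrite e_irr.
Qed.

Lemma col_colorable k : col k [set: T] -> colorable e k.
Proof.
move=> [c [c_lt cP]].
exists (fun v => Ordinal (c_lt v (in_setT v))) => u v uv.
by apply: contraNneq (cP u v (in_setT u) (in_setT v) uv) => -[->].
Qed.

Definition P3free (S : {set T}) :=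
  forall a b c, a \in S -> b \in S -> c \in S ->
    e a b -> e b c -> a != c -> e a c.

Definition triangle_free (S : {set T}) :=
  forall a b c, a \in S -> b \in S -> c \in S ->
    e a b -> e b c -> e a c -> False.

(* In a disjoint union of cliques, colour a vertex by the number of
   neighbours enumerated before it. *)
Lemma col_P3free k (S : {set T}) : P3free S ->
  (forall v (Q : {set T}), v \in S -> Q \subset S -> (forall w, w \in Q -> e v w) ->
     {in Q &, forall w w', w != w' -> e w w'} -> #|Q| < k) ->
  col k S.
Proof.
move=> P3 small.
pose Q v := [set w in S | e v w & enum_rank w < enum_rank v].
exists (fun v => #|Q v|); split=> [v vS|].
  apply: (small v) => //.
  - by apply/subsetP => w; rewrite inE => /and3P[].
  - by move=> w; rewrite inE => /and3P[].
  - move=> w w'; rewrite !inE => /and3P[wS vw _] /and3P[w'S vw' _] nww'.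
    by apply: (P3 w v w') => //; rewrite e_sym.
suff lt u v : u \in S -> v \in S -> e u v -> enum_rank u < enum_rank v -> #|Q u| < #|Q v|.
  move=> u v uS vS uv; case: (ltngtP (enum_rank u) (enum_rank v)) => E.
  - by rewrite neq_ltn lt.
  - by rewrite neq_ltn (lt v u) ?orbT // e_sym.
  - by move/ord_inj/enum_rank_inj: E uv => ->; rewrite e_irr.
(* By P3-freeness every earlier neighbour of [u] is also one of [v]; moreover [u] is counted at [v]
   but not at [u], so the inequality is strict. *)
move=> uS vS uv ruv; apply: proper_card; apply/properP; split; last first.
  by exists u; rewrite !inE ?ltnn ?andbF // uS ruv e_sym uv.
apply/subsetP => w; rewrite !inE => /and3P[wS uw rwu]; rewrite wS (ltn_trans rwu ruv) andbT /=.
apply: (P3 v u w) => //; first by rewrite e_sym.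
by apply: contraTneq rwu => <-; rewrite -leqNgt ltnW.
Qed.

Lemma col2_P3free S : P3free S -> triangle_free S -> col 2 S.
Proof.
move=> P3 tf; apply: (col_P3free P3) => v Q vS /subsetP QS vQ cl.
rewrite ltnNge; apply/negP => /card_gt1P[w [w' [wQ w'Q nww']]].
exact: tf vS (QS _ wQ) (QS _ w'Q) (vQ _ wQ) (cl _ _ wQ w'Q nww') (vQ _ w'Q).
Qed.

Definition K4free := forall a b c d,
  e a b -> e a c -> e a d -> e b c -> e b d -> e c d -> False.

Lemma col3_P3free S : P3free S ->
  K4free ->
  col 3 S.
Proof.
move=> P3 k4; apply: (col_P3free P3) => v Q vS /subsetP QS vQ cl.
rewrite ltnNge; apply/negP => /card_gt2P[w [w' [w'' [[wQ w'Q w''Q] [n1 n2 n3]]]]].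
apply: (k4 v w w' w'' (vQ _ wQ) (vQ _ w'Q) (vQ _ w''Q)); apply: cl => //.
by rewrite eq_sym.
Qed.


(** Only [a] and [c] have the same neighbours in this pattern; the listed adjacencies already force
    every other pair apart. *)
Definition P3P2free := forall a b c d f, e a b -> e b c -> a != c -> ~~ e a c ->
  e d f -> ~~ e a d -> ~~ e a f -> ~~ e b d -> ~~ e b f -> ~~ e c d -> ~~ e c f -> False.

Definition is_C5 (c1 c2 c3 c4 c5 : T) :=
  [&& e c1 c2, e c2 c3, e c3 c4, e c4 c5, e c5 c1,
      ~~ e c1 c3, ~~ e c2 c4, ~~ e c3 c5, ~~ e c4 c1 & ~~ e c5 c2].

(* Without short odd closed walks, avoiding P3 u P2 lets every walk with
   five edges be replaced by one with three, so the parity of walks from a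
   root is a proper colouring. *)
Lemma col2_or_C5 S : P3P2free -> triangle_free S ->
  col 2 S \/ exists c1 c2 c3 c4 c5, [&& c1 \in S, c2 \in S, c3 \in S, c4 \in S & c5 \in S]
                                 /\ is_C5 c1 c2 c3 c4 c5.
Proof.
move=> P3P2 tf.
pose r := [rel u v | [&& u \in S, v \in S & e u v]].
have rP u v : r u v -> [/\ u \in S, v \in S & e u v] by case/and3P.
have rsym u v : r u v = r v u by rewrite /= e_sym andbCA.
have [ex|no5] := boolP [exists c1, exists c2, exists c3, exists c4, exists c5,
  [&& r c1 c2, r c2 c3, r c3 c4, r c4 c5 & r c5 c1]].
  right; move: ex => /existsP[c1 /existsP[c2 /existsP[c3 /existsP[c4 /existsP[c5]]]]].
  case/and5P=> /rP[S1 common_nbhd e12] /rP[_ S3 e23] /rP[_ S4 e34] /rP[_ S5 e45] /rP[_ _ e51].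
  exists c1, c2, c3, c4, c5; split; first exact/and5P.
  (* A chord of the closed walk would join two vertices two steps apart and create a triangle, so
     the walk is an induced cycle. *)
  have tf' a b c : a \in S -> b \in S -> c \in S -> e a b -> e b c -> ~~ e a c.
    by move=> ? ? ? ab bc; apply/negP => ac; apply: (tf a b c).
  by rewrite /is_C5 e12 e23 e34 e45 e51 /= (tf' c1 c2) ?(tf' c2 c3) ?(tf' c3 c4) ?(tf' c4 c5) ?(tf' c5 c1).
left.
have {}no5 a b c d f : r a b -> r b c -> r c d -> r d f -> r f a -> False.
  move=> ab bc cd df fa; case/negP: no5.
  apply/existsP; exists a; apply/existsP; exists b; apply/existsP; exists c.
  by apply/existsP; exists d; apply/existsP; exists f; apply/and5P.
(* [O u v] means that a walk with exactly three edges, possibly repeating vertices, joins [u] to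
   [v]. *)
pose O u v := [exists w, exists w', [&& r u w, r w w' & r w' v]].
have OI u w w' v : r u w -> r w w' -> r w' v -> O u v.
  by move=> *; apply/existsP; exists w; apply/existsP; exists w'; apply/and3P.
(* Unless [a = c], [P3P2] for the path [a b c] and the edge [f g] yields an edge between them. Here
   [a f] and [b g] close a walk with five edges, [c f] closes a triangle, and [a g], [b f], [c g]
   each give a walk with three edges. *)
have red a b c d f g : r a b -> r b c -> r c d -> r d f -> r f g -> O a g.
  move=> ab bc cd df fg.
  have [aS bS eab] := rP _ _ ab; have [_ cS ebc] := rP _ _ bc.
  have [_ dS ecd] := rP _ _ cd; have [_ fS edf] := rP _ _ df; have [_ gS efg] := rP _ _ fg.
  have [Eac|nac] := eqVneq a c; first by apply: (OI a d f); rewrite ?Eac.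
  have rI u v : u \in S -> v \in S -> e u v -> r u v by move=> *; apply/and3P.
  have [af|naf] := boolP (e a f); first by case: (no5 a b c d f ab bc cd df); apply: rI; rewrite // e_sym.
  have [ag|nag] := boolP (e a g).
    by apply: (OI a g a g); apply: rI; rewrite // e_sym.
  have [bf|nbf] := boolP (e b f); first by apply: (OI a b f) => //; apply: rI.
  have [bg|nbg] := boolP (e b g); first by case: (no5 b c d f g bc cd df fg); apply: rI; rewrite // e_sym.
  have [cf|ncf] := boolP (e c f); first by case: (tf c d f).
  have [cg|ncg] := boolP (e c g); first by apply: (OI a b c) => //; apply: rI.
  case: (P3P2 a b c f g) => //; apply/negP => ac; exact: (tf a b c).
have csym : connect_sym r by apply: sym_connect_sym => u v; exact: rsym.
(* Since five edges reduce to three, every vertex of the component is [t], the end of a three-edge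
   walk, or a neighbour of such an end. *)
have walk t v : connect r t v -> [\/ v = t, O t v | exists2 m, O t m & r m v].
  move=> /connectP[p pth ->]; elim/last_ind: p pth => [|p w IH]; first by constructor 1.
  rewrite rcons_path last_rcons => /andP[/IH + lw]; case=> [E|Olast|[m Om rm]].
  - constructor 2; rewrite E in lw; by apply: (OI t w t) => //; move: lw; rewrite rsym.
  - by constructor 3; exists (last t p).
  - constructor 2; move: Om => /existsP[a /existsP[b /and3P[ta ab bm]]].
    exact: (red _ a b m (last t p)).
exists (fun v => O (root r v) v : nat); split=> [v _|u v uS vS uv]; first by case: (O _ _).
have ruv : r u v by apply/and3P.
have rvu : r v u by move: ruv; rewrite rsym.
have -> : root r v = root r u by apply/esym/eqP; rewrite root_connect // connect1.
set t := root r u.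
have tu : connect r t u by rewrite csym connect_root.
have tv : connect r t v by apply: (connect_trans tu); apply: connect1.
(* If both ends are odd, the walk [t a b u v d] reduces to three edges and closes up with [d c t] to
   a walk with five edges. If neither is, [u] is [t] or four steps away, which makes [v] odd. *)
case Ou: (O t u); case Ov: (O t v) => //.
  move: Ou Ov => /existsP[a /existsP[b /and3P[ta ab bu]]] /existsP[c /existsP[d /and3P[tc cd dv]]].
  have /existsP[x /existsP[y /and3P[tx xy yd]]] : O t d.
    by apply: (red t a b u v d) => //; move: dv; rewrite rsym.
  by case: (no5 t x y d c tx xy yd); [move: cd | move: tc]; rewrite rsym.
case: (walk t u tu) => [E|| [m Om mu]]; rewrite ?Ou //.
  by move: Ov; rewrite (OI t v t v) // -E.
move: Om Ov => /existsP[a /existsP[b /and3P[ta ab bm]]].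
by rewrite (red t a b m u v).
Qed.

End Colouring.

(** * Forbidden subgraphs *)

Definition adj_in (E : seq (nat * nat)) (i j : nat) := ((i, j) \in E) || ((j, i) \in E).

(** This is the adjacency matrix strictly above the diagonal, so one equation between lists settles
    every pair once. *)
Fixpoint upper (U : Type) (h : rel U) (s : seq U) : seq (seq bool) :=
  if s is x :: s' then map (h x) s' :: upper h s' else [::].

Section Embedding.
Variables (T : finType) (e : rel T).
Hypotheses (e_sym : symmetric e) (e_irr : irreflexive e).

Definition realizes k (h : nat -> nat -> bool) (g : nat -> T) :=
  forall i j, i < k -> j < k -> i != j -> e (g i) (g j) = h i j /\ g i <> g j.

Lemma free_realizes k E (g : nat -> T) :
  free e (@graph_of k E) -> all (fun p => p.1 != p.2) E -> ~ realizes k (adj_in E) g.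
Proof.
move=> fr /allP loopless gP; apply: fr; exists (fun i => g (val i)); split=> [i j gij|i j].
  apply/eqP/contraT => nij.
  by have [] := gP i j (ltn_ord i) (ltn_ord j) nij.
have [->|nij] := eqVneq i j; last by case: (gP i j (ltn_ord i) (ltn_ord j) nij).
rewrite e_irr /graph_of orbb; apply/esym/negP => /loopless /=; by rewrite eqxx.
Qed.

(** If [g i = g j], rows [i] and [j] of [h] coincide; distinctness therefore needs a separate
    argument only for twins. *)
Lemma realizes_ltn k h g : symmetric h ->
  (forall i j, i < j -> j < k -> e (g i) (g j) = h i j) ->
  (forall i j, i < j -> j < k -> (forall l, l < k -> h i l = h j l) -> g i <> g j) ->
  (forall i, h i i = false) ->
  realizes k h g.
Proof.
move=> hs gP tw hi.
have ge i j : i < k -> j < k -> e (g i) (g j) = h i j.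
  move=> ik jk; case: (ltngtP i j) => [ij|ji|->]; first exact: gP.
    by rewrite e_sym hs gP.
  by rewrite e_irr hi.
move=> i j ik jk nij; split; first exact: ge.
wlog ij : i j ik jk nij / i < j.
  move=> W; have := nij; rewrite neq_ltn => /orP[ij|ji]; first exact: W.
  by move/esym; apply: (W j i) => //; rewrite eq_sym.
by move=> E; apply: (tw i j) => // l lk; rewrite -!ge // E.
Qed.

Lemma adj_in_sym E : symmetric (adj_in E).
Proof. by move=> i j; rewrite /adj_in orbC. Qed.

Lemma upperP (U : Type) (h : rel U) (vs : seq T) (us : seq U) x0 u0 i j :
  upper e vs = upper h us -> i < j -> j < size us ->
  e (nth x0 vs i) (nth x0 vs j) = h (nth u0 us i) (nth u0 us j).
Proof.
elim: vs us i j => [|v vs IH] [|u us] // i [|j] //= [E /IH H]; rewrite ltnS => ij js.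
have sz : size vs = size us by rewrite -(size_map (e v)) E size_map.
case: i ij => [|i] ij /=; last exact: H.
by rewrite -(nth_map x0 false) ?sz // E (nth_map u0).
Qed.

Lemma free_upper k E (vs : seq T) x0 :
  free e (@graph_of k E) -> all (fun p => p.1 != p.2) E ->
  upper e vs = upper (adj_in E) (iota 0 k) ->
  (forall i j, i < j -> j < k ->
     all (fun l => adj_in E i l == adj_in E j l) (iota 0 k) -> nth x0 vs i <> nth x0 vs j) ->
  False.
Proof.
move=> fr ll up tw; apply: (free_realizes fr ll (g := nth x0 vs)).
apply: realizes_ltn => [|i j ij jk|i j ij jk H|i].
- exact: adj_in_sym.
- by rewrite (upperP x0 0 up) ?size_iota ?nth_iota // (ltn_trans ij).
- apply: tw => //; apply/allP => l; rewrite mem_iota => /H->; exact: eqxx.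
- by apply/negP; rewrite /adj_in orbb => /(allP ll); rewrite eqxx.
Qed.

Lemma P3P2free_of_free : free e P3uP2 -> P3P2free e.
Proof.
move=> fr a b c d f ab bc /eqP nac ac df ad af bd bf cd cf.
apply: (@free_upper _ _ [:: a; b; c; d; f] a fr) => //.
  by rewrite /= ab bc df !(negPf ac, negPf ad, negPf af, negPf bd, negPf bf, negPf cd, negPf cf).
(* The only twins are the two ends of the path, which [nac] separates. *)
by move=> [|[|[|[|[|i]]]]] [|[|[|[|[|j]]]]].
Qed.

Lemma K4free_of_free : free e K4 -> K4free e.
Proof.
move=> fr a b c d ab ac ad bc bd cd; apply: fr.
have P : forall i j : 'I_4, i != j ->
    e (nth a [:: a; b; c; d] i) (nth a [:: a; b; c; d] j).
  by move=> [[|[|[|[|i]]]] Hi] [[|[|[|[|j]]]] Hj] //= _; rewrite 1?e_sym.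
exists (fun i : 'I_4 => nth a [:: a; b; c; d] i); split=> [i j E|i j].
  by apply/eqP/contraT => /P; rewrite E e_irr.
by rewrite /K4; have [->|/P] := eqVneq i j; rewrite ?e_irr.
Qed.

(** Neither the co-domino nor the co-A has two vertices with the same neighbourhood, so adjacencies
    alone determine an embedding. *)
Definition co_domino_free := forall u1 v1 v2 v3 u3 u2,
  e u1 v1 -> e v1 v2 -> e v2 v3 -> e v3 u3 -> e u3 u2 -> e u2 u1 -> e v1 v3 -> e u1 u3 ->
  ~~ e u1 v2 -> ~~ e u1 v3 -> ~~ e v1 u3 -> ~~ e v1 u2 -> ~~ e v2 u3 -> ~~ e v2 u2 ->
  ~~ e v3 u2 -> False.

Definition co_A_free := forall u1 v1 v2 v3 u3 u2,
  e u1 v1 -> e v1 v2 -> e v2 v3 -> e v3 u3 -> e u3 u2 -> e u2 u1 -> e v1 v3 -> e u1 u3 ->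
  e u1 v3 -> ~~ e u1 v2 -> ~~ e v1 u3 -> ~~ e v1 u2 -> ~~ e v2 u3 -> ~~ e v2 u2 ->
  ~~ e v3 u2 -> False.

Lemma co_domino_free_of_free : free e co_domino -> co_domino_free.
Proof.
move=> fr u1 v1 v2 v3 u3 u2 p1 p2 p3 p4 p5 p6 p7 p8 n1 n2 n3 n4 n5 n6 n7.
apply: (@free_upper _ _ [:: u1; v1; v2; v3; u3; u2] u1 fr) => //.
  by rewrite /= (e_sym u1 u2) p1 p2 p3 p4 p5 p6 p7 p8 !(negPf n1, negPf n2, negPf n3, negPf n4, negPf n5, negPf n6, negPf n7).
by move=> [|[|[|[|[|[|i]]]]]] [|[|[|[|[|[|j]]]]]].
Qed.

Lemma co_A_free_of_free : free e co_A -> co_A_free.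
Proof.
move=> fr u1 v1 v2 v3 u3 u2 p1 p2 p3 p4 p5 p6 p7 p8 p9 n1 n2 n3 n4 n5 n6.
apply: (@free_upper _ _ [:: u1; v1; v2; v3; u3; u2] u1 fr) => //.
  by rewrite /= (e_sym u1 u2) p1 p2 p3 p4 p5 p6 p7 p8 p9 !(negPf n1, negPf n2, negPf n3, negPf n4, negPf n5, negPf n6).
by move=> [|[|[|[|[|[|i]]]]]] [|[|[|[|[|[|j]]]]]].
Qed.

End Embedding.

(** * Neighbourhoods *)

Section Structure.
Variables (T : finType) (e : rel T).
Hypotheses (e_sym : symmetric e) (e_irr : irreflexive e).
Hypothesis P3P2 : P3P2free e.
Hypothesis k4 : K4free e.
Local Notation col := (col e).

Definition triangle a b c := [&& e a b, e b c & e a c].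
Definition misses x a b c := [&& ~~ e x a, ~~ e x b & ~~ e x c].

Lemma adj_neq u v w : e u w -> ~~ e v w -> u != v.
Proof. by move=> uw; apply: contraNneq => <-. Qed.

Lemma triangle_rot a b c : triangle a b c -> triangle b c a.
Proof. by case/and3P=> ab bc ac; apply/and3P; split; rewrite // e_sym. Qed.

Lemma misses_rot x a b c : misses x a b c -> misses x b c a.
Proof. by case/and3P=> ? ? ?; apply/and3P. Qed.

(** If [v] misses both [x] and [y], the path [v a b] is anticomplete to [x y]; if it sees only [y],
    the path [v y x] is anticomplete to [b c]. *)
Lemma single_adj_edge a b c x y v : triangle a b c -> e x y ->
  misses x a b c -> misses y a b c -> e v a -> ~~ e v b -> ~~ e v c -> e v x && e v y.
Proof.
move=> /and3P[ab bc ac].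
wlog suff W : x y / e x y -> misses x a b c -> misses y a b c ->
    e v a -> ~~ e v b -> ~~ e v c -> e v y -> e v x.
  move=> xy xT yT va vb vc; have yx : e y x by rewrite e_sym.
  have [vx|vx] := boolP (e v x); first by rewrite (W y x).
  have [vy|vy] := boolP (e v y); first by rewrite (W x y) // in vx.
  case/and3P: xT => xa xb xc; case/and3P: yT => ya yb yc.
  have nvb : v != b by rewrite eq_sym (adj_neq bc).
  by case: (P3P2 va ab nvb vb xy vx vy); rewrite e_sym.
move=> xy /and3P[xa xb xc] /and3P[ya yb yc] va vb vc vy; apply: contraT => vx.
have yx : e y x by rewrite e_sym.
by case: (P3P2 vy yx (adj_neq va xa) vx bc vb vc).
Qed.

Definition common_nbhd u v : {set T} := [set w | e w u & e w v].

Lemma col1_common_nbhd u v : e u v -> col 1 (common_nbhd u v).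
Proof.
move=> uv; apply: col_stable => w w'; rewrite !inE => /andP[wu wv] /andP[w'u w'v].
by apply/negP => ww'; apply: (k4 ww' wu wv w'u w'v uv).
Qed.

Lemma col7_triangle_edge a b c x y : triangle a b c -> e x y ->
  misses x a b c -> misses y a b c -> col 7 [set: T].
Proof.
move=> tr xy xT yT; have /and3P[ab bc ac] := tr.
pose A0 := [set v | misses v a b c].
pose R := [set v | (e v a + e v b + e v c) == 1].
have c3 : col 3 A0.
  apply: col3_P3free => // u v w; rewrite !inE => /and3P[ua ub _] /and3P[va vb _] /and3P[wa wb _].
  move=> uv vw uw; apply: contraT => nuw.
  by case: (P3P2 uv vw uw nuw ab).
(* Vertices with one neighbour on the triangle are common neighbours of [x] and [y], hence form a
   stable set. *)
have Radj v : v \in R -> e v x && e v y.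
  rewrite inE; case va: (e v a); case vb: (e v b); case vc: (e v c) => // _.
  - by apply: (single_adj_edge tr) => //; rewrite ?vb ?vc.
  - by apply: (single_adj_edge (triangle_rot tr)); rewrite -?misses_rot ?vb ?vc ?va //;
      apply: misses_rot.
  - by apply: (single_adj_edge (triangle_rot (triangle_rot tr))); rewrite ?vb ?vc ?va //;
      do 2!apply: misses_rot.
have c1 : col 1 R.
  apply: col_sub (col1_common_nbhd xy); apply/subsetP => v /Radj; by rewrite inE.
apply: col_sub (colU c3 (colU c1 (colU (col1_common_nbhd ab) (colU (col1_common_nbhd bc) (col1_common_nbhd ac))))).
apply/subsetP => v _; rewrite !inE /misses.
by case: (e v a); case: (e v b); case: (e v c).
Qed.

Definition K3K2free := forall a b c x y, triangle a b c -> e x y ->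
  misses x a b c -> misses y a b c -> False.

Hypothesis K3K2 : K3K2free.

Definition anti u v : {set T} := [set w | ~~ e w u & ~~ e w v].

(** An induced path on three vertices or a triangle in this set would be anticomplete to [uv]; the
    set thus induces a matching and isolated vertices. *)
Lemma col2_anti u v : e u v -> col 2 (anti u v).
Proof.
move=> uv; apply: col2_P3free => // a b c; rewrite !inE => /andP[au av] /andP[bu bv] /andP[cu cv].
  move=> ab bc ac; apply: contraT => nac; by case: (P3P2 ab bc ac nac uv).
by move=> ab bc ac; apply: (K3K2 (a := a) (b := b) (c := c) _ uv);
   apply/and3P; rewrite // !(e_sym _ a, e_sym _ b, e_sym _ c).
Qed.

Lemma col1_nbhd (S : {set T}) u : u \in S -> triangle_free e S -> col 1 [set w in S | e w u].
Proof.
move=> uS tf; apply: col_stable => v w; rewrite !inE => /andP[vS vu] /andP[wS wu].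
by apply/negP => vw; apply: (tf v w u).
Qed.

(** For an edge [yz] inside [S], the neighbours of [y] and those of [z] in [S] form two stable sets,
    and the rest is anticomplete to [yz]. *)
Lemma col4_triangle_free S : triangle_free e S -> col 4 S.
Proof.
move=> tf.
have [/existsP[y /existsP[z /and3P[yS zS yz]]]|] := boolP [exists y, exists z, [&& y \in S, z \in S & e y z]].
  apply: col_sub (colU (colU (col1_nbhd yS tf) (col1_nbhd zS tf)) (col2_anti yz)).
  by apply/subsetP => v vS; rewrite !inE vS; case: (e v y); case: (e v z).
move=> st; apply: (@col_leq _ _ 1) => //; apply: col_stable => u v uS vS.
apply: contra st => uv; apply/existsP; exists u; apply/existsP; exists v; exact/and3P.
Qed.

Lemma triangle_free_nbhd x : triangle_free e (nbhd e x).
Proof.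
move=> a b c; rewrite !inE => xa xb xc ab bc ac; exact: (k4 xa xb xc ab ac bc).
Qed.

(** One colour serves N(x), two serve the vertices anticomplete to [xu], and four serve the
    triangle-free N(u). *)
Lemma col7_stable_nbhd x u : e x u -> (forall v w, e x v -> e x w -> ~~ e v w) -> col 7 [set: T].
Proof.
move=> xu st.
have c1 : col 1 (nbhd e x) by apply: col_stable => v w; rewrite !inE; apply: st.
apply: col_sub (colU (colU c1 (col2_anti xu)) (col4_triangle_free (triangle_free_nbhd (x := u)))).
by apply/subsetP => v _; rewrite !inE (e_sym v) (e_sym u); case: (e x v); case: (e v u).
Qed.

Lemma col7_bipartite_nbhd x u y : e x u -> e x y -> e u y ->
  col 2 (nbhd e x :\ y) -> col 7 [set: T].
Proof.
move=> xu xy uy c2.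
have c2' : col 2 (y |: anti x y).
  apply: col_isolated => //; last exact: col2_anti.
  by move=> v; rewrite inE (e_sym y) => /andP[].
apply: col_sub (colU (colU c2 c2') (colU (col2_anti xu) (col1_common_nbhd uy))).
apply/subsetP => v _; rewrite !inE; have [//|_] := eqVneq v y.
by rewrite (e_sym v x); case: (e x v); case: (e v u); case: (e v y).
Qed.

Lemma col7_no_isolated_miss :
  (forall x y a b c, e x y -> triangle a b c -> misses x a b c -> False) -> col 7 [set: T].
Proof.
move=> no.
have [/existsP[a /existsP[a' aa']]|st] := boolP [exists a, exists b, e a b]; last first.
  apply: (@col_leq _ _ 1) => //; apply: col_stable => u v _ _.
  by apply: contra st => uv; apply/existsP; exists u; apply/existsP; exists v.
have [/existsP[m /existsP[n /and3P[am an mn]]]|st] :=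
  boolP [exists m, exists n, [&& ~~ e m a, ~~ e n a & e m n]]; last first.
  have c1 : col 1 (~: nbhd e a).
    apply: col_stable => u v; rewrite !inE !(e_sym a) => ua va; apply: contra st => uv.
    by apply/existsP; exists u; apply/existsP; exists v; apply/and3P.
  apply: (@col_leq _ _ 5) => //.
  apply: col_sub (colU c1 (col4_triangle_free (triangle_free_nbhd (x := a)))).
  by apply/subsetP => v _; rewrite !inE orNb.
have nm : e n m by rewrite e_sym.
(* An edge [vw] in this set would form with [p] a triangle missed by [q], which is not isolated
   because of [r]. *)
have off p q r : e q r -> ~~ e q p -> col 1 [set v | e v p & ~~ e v q].
  move=> qr qp; apply: col_stable => v w; rewrite !inE => /andP[vp vq] /andP[wp wq].
  by apply/negP => vw; apply: (no q r p v w) => //; apply/and3P; split; rewrite // e_sym.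
have am' : ~~ e a m by rewrite e_sym.
have an' : ~~ e a n by rewrite e_sym.
apply: col_sub (colU (colU (off a m n mn am) (colU (off a n m nm an) (col1_common_nbhd mn)))
  (colU (colU (off m a a' aa' am') (off n a a' aa' an')) (col2_anti mn))).
apply/subsetP => v _; rewrite !inE.
by case: (e v a); case: (e v m); case: (e v n).
Qed.

End Structure.

(** * Certified colourings *)

(* A row [(p, q)] describes a vertex relative to a list of labelled vertices:
   bit [i] of [p] (of [q]) says that it is adjacent to (distinct from and not
   adjacent to) the vertex labelled [i]. *)
Definition row : Type := N * N.

Definition put (r : row) n (x y : bool) : row :=
  (if x then N.setbit r.1 n else N.clearbit r.1 n,
   if y then N.setbit r.2 n else N.clearbit r.2 n).

Definition side (r : row) (b : bool) : N := if b then r.1 else r.2.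

(* [vm_compute] evaluates both arguments of [&&]. *)
Notation "a &&& b" := (if a then b else false) (at level 40, left associativity).

(** This is [has] with a conditional in place of the disjunction, so that [vm_compute] stops at the
    first witness. *)
Fixpoint some (U : Type) (p : pred U) (s : seq U) : bool :=
  if s is x :: s' then (if p x then true else some p s') else false.

Lemma someE (U : Type) (p : pred U) s : some p s = has p s.
Proof. by elim: s => //= x s ->. Qed.

(** Backtracking search: [m k] is the bit mask of labels still admissible for pattern vertex [k],
    and placing one vertex intersects the other masks with the matching side of its row. *)
Fixpoint extends (h : nat -> nat -> bool) (B : seq (N * row)) (ks : seq nat) (m : nat -> N) : bool :=
  if ks is k :: ks' then
    let mk := m k in
    some (fun ir => N.testbit mk ir.1 &&&
           extends h B ks' (fun k' => N.land (m k') (side ir.2 (h k k')))) B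
  else true.

(** The entries are two pinned vertices of a forbidden graph, its other vertices, and its adjacency
    matrix. *)
Definition pattern : Type := nat * nat * seq nat * seq (seq bool).

Definition entry (M : seq (seq bool)) i j := nth false (nth [::] M i) j.

Definition refute1 (B : seq (N * row)) (s t : row) (b : bool) (P : pattern) : bool :=
  let: (p, q, ks, M) := P in
  (entry M p q == b) &&&
  extends (entry M) B ks (fun k => N.land (side s (entry M p k)) (side t (entry M q k))).

Definition mk_pattern k (E : seq (nat * nat)) p q : pattern :=
  (p, q, [seq i <- iota 0 k | (i != p) && (i != q)],
   [seq [seq adj_in E i j | j <- iota 0 k] | i <- iota 0 k]).

Definition P3P2_edges := [:: (0,1); (1,2); (3,4)].
Definition K3K2_edges := [:: (0,1); (1,2); (0,2); (3,4)].
Definition K4_edges := [:: (0,1); (0,2); (0,3); (1,2); (1,3); (2,3)].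
Definition co_domino_edges := C6_edges ++ [:: (1, 3); (0, 4)].
Definition co_A_edges := C6_edges ++ [:: (1, 3); (0, 4); (0, 3)].

Definition forbidden : seq (nat * seq (nat * nat)) :=
  [:: (5, P3P2_edges); (5, K3K2_edges); (4, K4_edges); (6, co_domino_edges); (6, co_A_edges)].

(* One ordered pair of vertices for every orbit of the automorphism group. *)
Definition pinned_pairs : seq (seq (nat * nat)) :=
  [:: [:: (0,1); (0,2); (0,3); (1,0); (1,3); (3,0); (3,1); (3,4)];
      [:: (0,1); (0,3); (3,0); (3,4)];
      [:: (0,1)];
      [:: (0,1); (0,2); (0,3); (0,4); (0,5); (2,0); (2,1); (2,5)];
      [:: (0,1); (0,2); (0,3); (0,4); (0,5); (1,0); (1,2); (1,3); (1,4); (1,5);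
          (2,0); (2,1); (2,3); (2,4); (2,5)]].

Definition patterns : seq pattern := Eval vm_compute in
  flatten [seq [seq mk_pattern kE.1.1 kE.1.2 pq.1 pq.2 | pq <- kE.2]
          | kE <- zip forbidden pinned_pairs].

(* Two vertices with rows [s] and [t] cannot have adjacency [b]: some forbidden
   graph contains both and is completed by labelled vertices. *)
Definition refute B s t b := some (refute1 B s t b) patterns.

(* [ColourBy cb cl] colours the labelled vertices by [cb] and the possible rows
   of the other ones by [cl]; colour 4 is for labelled vertices that need none.
   [BranchOn i t1 t2] labels a vertex having the [i]-th row, if there is one. *)
Inductive certificate :=
  | ColourBy of seq nat & seq nat
  | BranchOn of nat & certificate & certificate.

(** The new label is marked neither adjacent nor non-adjacent to itself, so [extends] cannot place
    two pattern vertices on it. *)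
Definition add_base (B : seq (N * row)) n (s : row) : seq (N * row) :=
  rcons [seq (ir.1, put ir.2 n (N.testbit s.1 ir.1) (N.testbit s.2 ir.1)) | ir <- B]
        (n, put s n false false).

(** Each row splits by adjacency to the new vertex, and a half that would complete a forbidden graph
    is dropped. *)
Definition add_types (B : seq (N * row)) (L : seq row) n (s : row) : seq row :=
  flatten [seq [seq put t n b (~~ b) | b <- [:: true; false] & ~~ refute B t s b] | t <- L].

Definition next_label (B : seq (N * row)) : N := N.of_nat (size B).

Definition fresh (B : seq (N * row)) := next_label B \notin unzip1 B.

Definition bit3 (p : N) := N.testbit p 0 + N.testbit p 1 + N.testbit p 2.

(** Labelled vertices with two neighbours on the triangle are exempt from the four colours. The last
    test also pairs each row with itself, so the vertices sharing a row are pairwise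
    non-adjacent. *)
Definition check_leaf (B : seq (N * row)) (L : seq row) (cb cl : seq nat) : bool :=
  [&& size cb == size B, size cl == size L,
      all (fun c => c < 4) cl,
      all (fun bc => (1 < bit3 bc.1.2.1) || (bc.2 < 4)) (zip B cb),
      all (fun bc => all (fun bd => [|| bc.2 != bd.2, 3 < bc.2, bc.1.1 == bd.1.1 |
             N.testbit bc.1.2.2 bd.1.1]) (zip B cb)) (zip B cb),
      all (fun bc => all (fun sd => (bc.2 != sd.2) || N.testbit sd.1.2 bc.1.1)
             (zip L cl)) (zip B cb) &
      all (fun sc => all (fun td => if sc.2 == td.2 then refute B sc.1 td.1 true else true)
             (zip L cl)) (zip L cl)].

Fixpoint check (B : seq (N * row)) (L : seq row) (t : certificate) : bool :=
  match t with
  | ColourBy cb cl => check_leaf B L cb cl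
  | BranchOn i t1 t2 =>
      let s := nth (N0, N0) L i in
      let n := next_label B in
      [&& i < size L, fresh B,
          check (add_base B n s) (add_types B L n s) t1 &
          check B (take i L ++ drop i.+1 L) t2]
  end.

(** * Soundness of the certificate checker *)

Section Soundness.
Variables (T : finType) (e : rel T).
Hypotheses (e_sym : symmetric e) (e_irr : irreflexive e).
Hypothesis avoids : forall kE g, kE \in forbidden -> ~ realizes e kE.1 (adj_in kE.2) g.

Definition fits u v b := e u v = b /\ u <> v.

Lemma fitsC u v b : fits u v b -> fits v u b.
Proof. by case=> E /nesym nuv; split; rewrite // e_sym. Qed.

Definition describes (f : N -> T) (B : seq (N * row)) (u : T) (r : row) : bool :=
  all (fun jr => (N.testbit r.1 jr.1 ==> e u (f jr.1)) &&
                 (N.testbit r.2 jr.1 ==> ~~ e u (f jr.1) && (u != f jr.1))) B.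

Definition faithful f B := forall i r, (i, r) \in B -> describes f B (f i) r.

Lemma describesP f B u r b j r' :
  describes f B u r -> (j, r') \in B -> N.testbit (side r b) j -> fits u (f j) b.
Proof.
move=> /allP H /H /= /andP[H1 H2]; case: b => /= tb.
  rewrite tb /= in H1; split=> // E; by rewrite E e_irr in H1.
by move: H2; rewrite tb /= => /andP[/negPf ? /eqP].
Qed.

Lemma extendsP f B h ks m : faithful f B -> uniq ks -> symmetric h -> extends h B ks m ->
  exists g : nat -> T,
    (forall k, k \in ks -> exists i r, [/\ (i, r) \in B, N.testbit (m k) i & g k = f i]) /\
    (forall k l, k \in ks -> l \in ks -> k != l -> fits (g k) (g l) (h k l)).
Proof.
move=> fB + hs; elim: ks m => [|k ks IH] m /=.
  by exists (fun=> f N0); split.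
rewrite someE => /andP[kks uks] /hasP[[i r] iB /andP[/= mi /(IH _ uks)[g [gm gg]]]].
exists (fun l => if l == k then f i else g l); split=> [l|l l'].
  rewrite inE; case: eqP => [-> _|_ /= /gm[j [r' [jB + E]]]]; first by exists i, r.
  by rewrite N.land_spec => /andP[mj _]; exists j, r'.
have new l0 : l0 \in ks -> fits (f i) (g l0) (h k l0).
  move=> /gm[j [r' [jB + ->]]]; rewrite N.land_spec => /andP[_].
  by apply: describesP (fB _ _ iB) jB.
rewrite !inE; case: eqP => [-> _|_ /= lks]; case: eqP => [->|_ /= l'ks] //=.
- by rewrite eqxx.
- by move=> _; exact: new.
- by move=> _ _; apply: fitsC; rewrite hs; exact: new.
- exact: gg.
Qed.

Lemma patternsP P : P \in patterns ->
  exists kE p q, [/\ kE \in forbidden, P = mk_pattern kE.1 kE.2 p q, p < kE.1, q < kE.1 & p != q].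
Proof.
have ->: patterns = flatten [seq [seq mk_pattern kE.1.1 kE.1.2 pq.1 pq.2 | pq <- kE.2]
          | kE <- zip forbidden pinned_pairs] by [].
move=> /flatten_mapP[[kE s] kEs /mapP[[p q] pqs ->]]; exists kE, p, q; rewrite /=.
have : all (fun kEs => (kEs.1 \in forbidden) &&
    all (fun pq => [&& pq.1 < kEs.1.1, pq.2 < kEs.1.1 & pq.1 != pq.2]) kEs.2)
    (zip forbidden pinned_pairs) by [].
by move/allP/(_ _ kEs)/andP => [-> /allP/(_ _ pqs)/and3P[-> -> ->]].
Qed.

Lemma entry_mk k E i j : i < k -> j < k ->
  entry [seq [seq adj_in E i j | j <- iota 0 k] | i <- iota 0 k] i j = adj_in E i j.
Proof.
by move=> ik jk; rewrite /entry (nth_map 0) ?size_iota // (nth_map 0) ?size_iota // !nth_iota.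
Qed.

Lemma refuteP f B u v s t b : faithful f B -> describes f B u s -> describes f B v t ->
  u != v -> e u v = b -> ~~ refute B s t b.
Proof.
move=> fB us vt nuv uv; apply/negP; rewrite /refute someE => /hasP[P /patternsP[kE [p [q [kEF -> pk qk npq]]]]].
rewrite /refute1 /mk_pattern entry_mk //; set M := map _ _ => /andP[/eqP hpq].
set h := fun i j => (i < kE.1) && (j < kE.1) && adj_in kE.2 i j.
move=> ext.
have {}ext : extends h B [seq i <- iota 0 kE.1 | (i != p) && (i != q)]
    (fun k => N.land (side s (h p k)) (side t (h q k))).
  have tr : forall ks m m', all (fun k => k < kE.1) ks -> {in ks, m =1 m'} ->
      extends (entry M) B ks m -> extends h B ks m'.
    elim=> // k ks IH m m' /= /andP[kk kks] mm'; rewrite !someE => /hasP[ir irB /andP[tb H]].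
    apply/hasP; exists ir => //; rewrite -mm' ?mem_head // tb /=.
    apply: IH H => // l lks; have lk := allP kks l lks.
    by rewrite mm' ?inE ?lks ?orbT // /h kk lk /= entry_mk.
  apply: (tr _ _ _ _ _ ext).
    by apply/allP => k; rewrite mem_filter mem_iota => /andP[_].
  move=> k; rewrite mem_filter mem_iota => /andP[_ /= kk].
  by rewrite /h pk qk kk !entry_mk.
have hs : symmetric h by move=> i j; rewrite /h adj_in_sym [(i < _) && _]andbC.
have uks := filter_uniq (fun i => (i != p) && (i != q)) (iota_uniq 0 kE.1).
have [g [gm gg]] := extendsP fB uks hs ext.
(* The vertices [u] and [v] take the pinned places, and the labelled vertices found by the search
   take the others. *)
pose g' k := if k == p then u else if k == q then v else g k.
have hk i j : i < kE.1 -> j < kE.1 -> adj_in kE.2 i j = h i j.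
  by move=> ik jk; rewrite /h ik jk.
have new k : k \in [seq i <- iota 0 kE.1 | (i != p) && (i != q)] ->
    fits u (g k) (h p k) /\ fits v (g k) (h q k).
  move=> /gm[i [r [iB + ->]]]; rewrite N.land_spec => /andP[si ti].
  by split; [apply: describesP us iB si | apply: describesP vt iB ti].
have in_ks k : k < kE.1 -> k != p -> k != q ->
    k \in [seq i <- iota 0 kE.1 | (i != p) && (i != q)].
  by move=> kk kp kq; rewrite mem_filter mem_iota kp kq.
have huv : fits u v (h p q) by split; [rewrite -hk // hpq | apply/eqP].
apply: (avoids (g := g') kEF) => i j ik jk nij; rewrite hk // /g'.
have [Ei|ip] := eqVneq i p; have [Ej|jp] := eqVneq j p; subst.
- by rewrite eqxx in nij.
- have [->|jq] := eqVneq j q; first exact: huv.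
  by have [] := new j (in_ks j jk jp jq).
- have [->|iq] := eqVneq i q; first by rewrite hs; apply: fitsC.
  by rewrite hs; apply: fitsC; have [] := new i (in_ks i ik ip iq).
have [Ei|iq] := eqVneq i q; have [Ej|jq] := eqVneq j q; subst.
- by rewrite eqxx in nij.
- by have [] := new j (in_ks j jk jp jq).
- by rewrite hs; apply: fitsC; have [] := new i (in_ks i ik ip iq).
by apply: gg => //; apply: in_ks.
Qed.


(** Labels 0, 1, 2 stand for the triangle, whose own vertices fall outside this set because each has
    two neighbours on it. *)
Definition few (f : N -> T) : {set T} := [set v | e v (f 0%num) + e v (f 1%num) + e v (f 2%num) <= 1].

Definition covers f (B : seq (N * row)) (L : seq row) := forall v, v \in few f ->
  (forall i r, (i, r) \in B -> f i != v) -> exists2 s, s \in L & describes f B v s.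

Lemma describes_labels f B u r : describes f B u r =
  all (fun j => (N.testbit r.1 j ==> e u (f j)) &&
                (N.testbit r.2 j ==> ~~ e u (f j) && (u != f j))) (unzip1 B).
Proof. by rewrite all_map. Qed.

Lemma labels_add_base B n s : unzip1 (add_base B n s) = rcons (unzip1 B) n.
Proof. by rewrite /unzip1 map_rcons -map_comp. Qed.

Lemma testbit_put r n x y b j : N.testbit (side (put r n x y) b) j =
  if j == n then (if b then x else y) else N.testbit (side r b) j.
Proof.
have [->|/eqP/nesym nj] := eqVneq j n.
  by case: b x y => [] [] []; rewrite /= ?N.setbit_eq ?N.clearbit_eq.
by case: b x y => [] [] []; rewrite /= ?N.setbit_neq ?N.clearbit_neq.
Qed.

Lemma describes_put f B n (s : row) u (r : row) (x y : bool) : n \notin unzip1 B -> describes f B u r ->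
  (x -> e u (f n)) -> (y -> ~~ e u (f n) && (u != f n)) ->
  describes f (add_base B n s) u (put r n x y).
Proof.
rewrite !describes_labels labels_add_base all_rcons => nB /allP H Hx Hy.
have tb := testbit_put r n x y; have /= tb1 := tb true; have /= tb2 := tb false.
rewrite tb1 tb2 eqxx; apply/andP; split; first by apply/andP; split; apply/implyP.
apply/allP => j jB; rewrite tb1 tb2; have [E|_] := eqVneq j n; last exact: H.
by rewrite -E jB in nB.
Qed.

(** The half-row of [v] with its actual adjacency to the new vertex survives, since [refuteP] shows
    that an adjacency that occurs is never refuted. *)
Lemma add_vertex f B L n (s : row) : faithful f B -> covers f B L -> n \notin unzip1 B ->
  describes f B (f n) s ->
  faithful f (add_base B n s) /\ covers f (add_base B n s) (add_types B L n s).
Proof.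
move=> fB cB nB ns; split=> [i r|v vW out].
  rewrite mem_rcons inE => /orP[/eqP[-> ->]|/mapP[[j r'] jB [-> ->]]].
    exact: describes_put.
  apply: describes_put => //; first exact: fB.
    by move=> sj; have [] := @describesP f B (f n) s true j r' ns jB sj; rewrite e_sym.
  move=> sj; have [E nE] := @describesP f B (f n) s false j r' ns jB sj.
  by rewrite e_sym E; apply/eqP/nesym.
have nv : v != f n by rewrite eq_sym; apply: (out n (put s n false false)); rewrite mem_rcons mem_head.
have [|t tL vt] := cB v vW.
  move=> i r iB; apply: out; rewrite mem_rcons inE; apply/orP; right.
  by apply/mapP; exists (i, r).
exists (put t n (e v (f n)) (~~ e v (f n))).
  apply/flatten_mapP; exists t => //; apply/mapP; exists (e v (f n)) => //.
  rewrite mem_filter (refuteP fB vt ns nv (erefl _)).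
  by case: (e v _).
by apply: describes_put => // ->.
Qed.

Definition update (f : N -> T) n w := fun j => if j == n then w else f j.

Lemma describes_update f B n w u r : n \notin unzip1 B ->
  describes (update f n w) B u r = describes f B u r.
Proof.
move=> nB; rewrite !describes_labels; apply: eq_in_all => j jB; rewrite /update.
by have [E|//] := eqVneq j n; rewrite -E jB in nB.
Qed.

Lemma label_in i (r : row) (B : seq (N * row)) : (i, r) \in B -> i \in unzip1 B.
Proof. by move=> iB; apply/mapP; exists (i, r). Qed.

Lemma update_out f B n w i (r : row) : n \notin unzip1 B -> (i, r) \in B -> update f n w i = f i.
Proof.
by move=> nB /label_in iB; rewrite /update; have [E|//] := eqVneq i n; rewrite -E iB in nB.
Qed.

(** These are all candidate colours of [v], those of its labels before those of the rows it fits;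
    the colouring takes the head. *)
Definition colours f (CB : seq (N * row * nat)) (CL : seq (row * nat)) B v :=
  [seq bc.2 | bc <- CB & f bc.1.1 == v] ++ [seq sc.2 | sc <- CL & describes f B v sc.1].

Lemma head_colours f cb cl B L v : size cb = size B -> size cl = size L ->
  covers f B L -> v \in few f ->
  let c := head 0 (colours f (zip B cb) (zip L cl) B v) in
  (exists i r, [/\ (i, r, c) \in zip B cb, (i, r) \in B & f i = v]) \/
  ((forall i r, (i, r) \in B -> f i != v) /\
   exists s, (s, c) \in zip L cl /\ describes f B v s).
Proof.
move=> sB sL cov vW; rewrite /colours.
have zB : unzip1 (zip B cb) = B by rewrite unzip1_zip // sB.
have zL : unzip1 (zip L cl) = L by rewrite unzip1_zip // sL.
case E: [seq bc <- zip B cb | f bc.1.1 == v] => [|[[i r] c] q] /=.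
  right; have out i r : (i, r) \in B -> f i != v.
    rewrite -{1}zB => /mapP[[[j r'] c] jB [-> _]]; apply/negP => fj.
    by have := mem_filter (fun bc => f bc.1.1 == v) (j, r', c) (zip B cb); rewrite E jB /= fj.
  split=> //; case F: [seq sc <- zip L cl | describes f B v sc.1] => [|[s c] q] /=.
    have [s sL' vs] := cov v vW out; move: sL'; rewrite -zL => /mapP[[s' c] sc /= Es].
    by have := mem_filter (fun sc => describes f B v sc.1) (s', c) (zip L cl);
       rewrite F sc /= -Es vs.
  have := mem_filter (fun sc => describes f B v sc.1) (s, c) (zip L cl).
  by rewrite F mem_head /= => /esym/andP[vs sc]; exists s.
left; exists i, r; have := mem_filter (fun bc => f bc.1.1 == v) (i, r, c) (zip B cb).
rewrite E mem_head /= => /esym/andP[/eqP fi ic]; split=> //.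
by rewrite -zB; apply/mapP; exists (i, r, c).
Qed.

(** Set bits of a row only assert adjacencies, so their number is at most the true number of
    neighbours on the triangle. *)
Lemma bit3_few f B u r : {subset [:: 0%num; 1%num; 2%num] <= unzip1 B} ->
  describes f B u r -> u \in few f -> bit3 r.1 <= 1.
Proof.
move=> sub; rewrite describes_labels => /allP H; rewrite inE; apply: leq_trans.
have b j : j \in [:: 0%num; 1%num; 2%num] -> N.testbit r.1 j <= e u (f j).
  by move=> /sub/H/andP[/implyP]; case: (N.testbit _ _) => // /(_ isT)->.
by rewrite /bit3 !leq_add ?b.
Qed.

Lemma check_leaf_col f B L cb cl : {subset [:: 0%num; 1%num; 2%num] <= unzip1 B} ->
  faithful f B -> covers f B L -> check_leaf B L cb cl -> col e 4 (few f).
Proof.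
move=> sub fB cov /and5P[/eqP sB /eqP sL cl4 cb4 /and3P[cBB cBL cLL]].
pose c v := head 0 (colours f (zip B cb) (zip L cl) B v); exists c.
have cP v := @head_colours f cb cl B L v sB sL cov.
have lt4 v : v \in few f -> c v < 4.
  move=> vW; case: (cP v vW) => [[i [r [ic iB fi]]]|[_ [s [sc _]]]].
    have /allP/(_ _ ic)/= := cb4; case/orP => // H; exfalso.
    have vr : describes f B v r by rewrite -fi; apply: fB.
    by have := bit3_few sub vr vW; rewrite leqNgt H.
  by apply: (allP cl4); have := map_f snd sc; rewrite -/(unzip2 _) unzip2_zip // sL.
split=> // u v uW vW uv; have un := lt4 u uW; have vn := lt4 v vW.
apply/negP => /eqP Ec.
have BL u' v' : e u' v' -> c u' = c v' ->
   (exists i r, [/\ (i, r, c u') \in zip B cb, (i, r) \in B & f i = u']) ->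
   (exists s, (s, c v') \in zip L cl /\ describes f B v' s) -> False.
  move=> uv' Ec' [i [r [ic iB fi]]] [s [sc vs]].
  have /allP/(_ _ ic)/allP/(_ _ sc)/= := cBL; rewrite Ec' eqxx /= => sj.
  have [] := @describesP f B v' s false i r vs iB sj.
  by rewrite fi e_sym uv'.
case: (cP u uW) => [[i [r [ic iB fi]]]|[_ us]]; case: (cP v vW) => [[j [r' [jc jB fj]]]|[_ vs]].
- have /allP/(_ _ ic)/allP/(_ _ jc)/= := cBB; rewrite -!/(c _) Ec eqxx /= ltnNge -ltnS vn /=.
  case/orP => [/eqP ij|rj]; first by rewrite -fi -fj ij e_irr in uv.
  have [] := @describesP f B u r false j r' _ jB rj; first by rewrite -fi; apply: fB.
  by rewrite fj uv.
- by apply: (BL u v) => //; exists i, r.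
- by apply: (BL v u) => //; [rewrite e_sym | exists j, r'].
move: us vs => [s [sc us]] [t [tc vt]].
have /allP/(_ _ sc)/allP/(_ _ tc)/= := cLL; rewrite -!/(c _) Ec eqxx /=.
apply/negP; apply: (refuteP fB us vt) => //.
by apply: contraTneq uv => ->; rewrite e_irr.
Qed.

Lemma check_col t f B L : {subset [:: 0%num; 1%num; 2%num] <= unzip1 B} ->
  faithful f B -> covers f B L -> check B L t -> col e 4 (few f).
Proof.
elim: t f B L => [cb cl|i t1 IH1 t2 IH2] f B L sub fB cov /=.
  exact: check_leaf_col.
set n := next_label B; set s := nth _ L i => /and4P[iL nB0 c1 c2].
have {nB0} nB : n \notin unzip1 B by [].
(* If an unlabelled vertex of [few] fits row [s], it receives the fresh label [n], which leaves the
   triangle and hence [few] unchanged. Otherwise the row can be deleted from [L]. *)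
have [ex|no] := boolP [exists w, [&& w \in few f,
    [forall k : 'I_(size B), f (nth N0 (unzip1 B) k) != w] & describes f B w s]].
  case/existsP: ex => w /and3P[_ _ ws].
  have E j : j \in unzip1 B -> update f n w j = f j.
    by move=> jB; rewrite /update; have [F|//] := eqVneq j n; rewrite -F jB in nB.
  have Ef : few (update f n w) = few f.
    by apply/setP => v; rewrite !inE !E ?sub ?inE.
  have fB' : faithful (update f n w) B.
    by move=> j r jB; rewrite describes_update // (update_out _ _ nB jB); apply: fB.
  have cov' : covers (update f n w) B L.
    move=> v; rewrite Ef => vW out; have [j r jB|t tL vt] := cov v vW.
      by rewrite -(update_out f w nB jB); apply: (out _ r).
    by exists t; rewrite ?describes_update.
  have [|fB2 cov2] := add_vertex fB' cov' nB (s := s).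
    by rewrite describes_update // /update eqxx.
  rewrite -Ef; apply: IH1 c1 => // j /sub jB; by rewrite labels_add_base mem_rcons inE jB orbT.
apply: IH2 c2 => // v vW out; have [t tL vt] := cov v vW out.
exists t => //; have Lcat := cat_take_drop i L; rewrite (drop_nth (N0, N0)) // -/s in Lcat.
have : t \in take i L ++ s :: drop i.+1 L by rewrite Lcat.
rewrite !mem_cat inE => /or3P[->|/eqP Et|->]; rewrite ?orbT //.
case/negP: no; apply/existsP; exists v; rewrite vW -Et vt andbT /=.
apply/forallP => k; have kB : k < size B by [].
case E: (nth (N0, (N0, N0)) B k) => [j r].
have -> : nth N0 (unzip1 B) k = j by rewrite (nth_map (N0, (N0, N0))) // E.
by apply: (out _ r); rewrite -E mem_nth.
Qed.

End Soundness.

(** * The three configurations and their certificates *)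

Fixpoint bits (s : seq bool) : N :=
  if s is b :: s' then (if b then N.succ_double (bits s') else N.double (bits s')) else N0.

Definition mk_row (s : seq bool) : row := (bits s, bits (map negb s)).

Definition grow (BL : seq (N * row) * seq row) (s : row) :=
  let n := next_label BL.1 in (add_base BL.1 n s, add_types BL.1 BL.2 n s).

Definition triangle_base : seq (N * row) * seq row :=
  (foldl (fun B s => add_base B (next_label B) s) [::]
     (map mk_row [:: [::]; [:: true]; [:: true; true]]),
   map mk_row [:: [:: true; false; false]; [:: false; true; false];
                  [:: false; false; true]; [:: false; false; false]]).

Definition matrix_entry (M : seq (seq bool)) i j :=
  if j < i then entry M i j else if i < j then entry M j i else false.

(** Without twins, a map respecting the adjacencies is injective, so distinctness of the
    configuration's vertices comes for free. *)
Definition twin_free (M : seq (seq bool)) :=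
  all (fun i => all (fun j => (i == j) ||
         has (fun l => matrix_entry M i l != matrix_entry M j l) (iota 0 (size M)))
       (iota 0 (size M))) (iota 0 (size M)).

Definition certified (M : seq (seq bool)) (t : certificate) :=
  [&& twin_free M, take 3 M == [:: [::]; [:: true]; [:: true; true]] &
      let BL := foldl grow triangle_base (map mk_row (drop 3 M)) in check BL.1 BL.2 t].

(* Row [k] lists the adjacencies of the [k]-th vertex to the earlier ones, in
   the order a, b, c (the triangle), x, then the 5-cycle in N(x), and in the last
   two cases one more neighbour of x.  The certificates come from a computer
   search. *)
Definition double_pentagon : seq (seq bool) :=
  [:: [::];
      [:: true];
      [:: true; true];
      [:: false; false; false];
      [:: true; true; false; true];
      [:: true; false; true; true; true];
      [:: true; true; false; true; false; true];
      [:: true; false; true; true; false; false; true];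
      [:: false; true; true; true; true; false; false; true]].

Definition double_pentagon_cert : certificate :=
 BranchOn 2
 (BranchOn 1
 (ColourBy [:: 4; 4; 4; 2; 4; 4; 4; 4; 4; 0; 0] [:: 0; 2; 0; 0; 0; 0; 1; 1; 1; 1; 1; 1; 3; 3; 3; 3; 3; 3; 2; 1; 3; 0; 2; 1; 0])
 (BranchOn 8
 (ColourBy [:: 4; 4; 4; 2; 4; 4; 4; 4; 4; 0; 1] [:: 0; 0; 1; 1; 1; 0; 2; 2; 1; 3; 3; 3; 2; 3; 3; 2; 1; 0; 2; 0; 0])
 (BranchOn 20
 (ColourBy [:: 4; 4; 4; 1; 4; 4; 4; 4; 4; 1; 2] [:: 1; 1; 0; 0; 0; 0; 0; 2; 3; 2; 3; 3; 2; 2; 3; 3; 0; 1; 0])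
 (BranchOn 20
 (ColourBy [:: 4; 4; 4; 3; 4; 4; 4; 4; 4; 0; 2] [:: 0; 1; 1; 1; 1; 1; 1; 1; 2; 0; 2; 2; 0; 0; 2; 2; 2; 0; 0; 3; 1; 0; 0; 0])
 (BranchOn 6
 (ColourBy [:: 4; 4; 4; 1; 4; 4; 4; 4; 4; 3; 0] [:: 0; 0; 0; 0; 0; 1; 1; 1; 3; 3; 3; 2; 1; 1; 2; 1; 1; 2; 3; 0; 2; 1; 0; 0; 0])
 (BranchOn 7
 (ColourBy [:: 4; 4; 4; 2; 4; 4; 4; 4; 4; 3; 2] [:: 1; 1; 1; 1; 1; 1; 1; 0; 0; 0; 0; 2; 3; 0; 0; 2; 2; 3; 3; 2; 0; 1; 0; 0; 0])
 (BranchOn 7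
 (ColourBy [:: 4; 4; 4; 1; 4; 4; 4; 4; 4; 3; 2] [:: 0; 2; 1; 1; 3; 1; 0; 2; 3; 3; 1; 1; 0; 2; 2; 3; 3; 1; 0; 0; 0; 0; 0])
 (BranchOn 15
 (ColourBy [:: 4; 4; 4; 2; 4; 4; 4; 4; 4; 2; 0] [:: 2; 2; 2; 0; 0; 0; 0; 1; 0; 1; 1; 3; 1; 1; 3; 3; 2; 2; 0])
 (BranchOn 16
 (ColourBy [:: 4; 4; 4; 1; 4; 4; 4; 4; 4; 1; 2] [:: 3; 3; 3; 3; 3; 3; 3; 3; 0; 0; 0; 0; 0; 0; 2; 1; 2; 1; 1; 1; 2; 2; 0; 1; 0; 0; 1; 0])
 (BranchOn 19
 (ColourBy [:: 4; 4; 4; 1; 4; 4; 4; 4; 4; 1; 1] [:: 0; 3; 3; 3; 2; 2; 2; 0; 1; 2; 2; 0; 0; 3; 3; 1; 3; 2; 1; 2; 1; 2; 0; 0; 1; 0; 0; 0; 0])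
 (BranchOn 21
 (ColourBy [:: 4; 4; 4; 0; 4; 4; 4; 4; 4; 0; 2] [:: 2; 2; 0; 1; 1; 0; 0; 3; 2; 1; 0; 0; 3; 0; 0; 1; 1; 0])
 (BranchOn 22
 (ColourBy [:: 4; 4; 4; 2; 4; 4; 4; 4; 4; 0; 2] [:: 0; 1; 1; 0; 0; 1; 1; 1; 1; 2; 1; 1; 1; 2; 0; 0; 0; 0; 0; 0; 1; 1; 0; 0; 0])
 (BranchOn 22
 (ColourBy [:: 4; 4; 4; 1; 4; 4; 4; 4; 4; 1; 3] [:: 1; 1; 1; 0; 0; 0; 0; 2; 0; 0; 2; 3; 2; 2; 3; 2; 0; 3; 0; 1; 0])
 (BranchOn 23
 (ColourBy [:: 4; 4; 4; 2; 4; 4; 4; 4; 4; 0; 2] [:: 0; 0; 2; 0; 0; 0; 1; 1; 2; 2; 1; 1; 1; 1; 3; 3; 3; 3; 3; 3; 0; 0; 1; 1; 0; 0; 0])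
 (BranchOn 23
 (ColourBy [:: 4; 4; 4; 2; 4; 4; 4; 4; 4; 1; 2] [:: 1; 1; 1; 1; 0; 0; 0; 2; 0; 3; 3; 2; 0; 1; 0])
 (BranchOn 23
 (ColourBy [:: 4; 4; 4; 0; 4; 4; 4; 4; 4; 0; 1] [:: 0; 0; 1; 1; 2; 1; 1; 2; 2; 2; 0; 0; 0])
 (BranchOn 24
 (ColourBy [:: 4; 4; 4; 2; 4; 4; 4; 4; 4; 2; 0] [:: 0; 0; 0; 2; 0; 1; 2; 0; 1; 2; 0; 1; 3; 3; 1; 2; 3; 0; 0; 0])
 (BranchOn 0
 (ColourBy [:: 4; 4; 4; 1; 4; 4; 4; 4; 4; 3; 0] [:: 0; 0; 0; 0; 2; 2; 3; 1; 3; 1; 2; 2; 1; 3; 1; 0; 0; 0])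
 (BranchOn 5
 (ColourBy [:: 4; 4; 4; 1; 4; 4; 4; 4; 4; 1; 0] [:: 1; 2; 1; 1; 1; 0; 0; 0; 0; 2; 0; 0; 0; 2; 2; 3; 3; 3; 3; 2; 0; 0; 0])
 (ColourBy [:: 4; 4; 4; 1; 4; 4; 4; 4; 4; 2] [:: 1; 1; 1; 2; 1; 3; 3; 2; 2; 0; 2; 3; 1; 0; 3; 1; 0; 0; 2; 0; 1; 1; 0]))))))))))))))))))))
 (ColourBy [:: 4; 4; 4; 3; 4; 4; 4; 4; 4] [:: 2; 2; 2; 2; 2; 2; 2; 0; 0; 0; 0; 0; 0; 0; 0; 0; 3; 3; 3; 0; 0; 0; 0; 1; 1; 1; 1; 1; 3; 1; 1; 3; 1; 1; 1; 3; 1; 1; 3; 0; 1; 3; 0; 0; 3; 2; 0; 2; 2; 0]).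

Definition single_pentagon0 : seq (seq bool) :=
  [:: [::];
      [:: true];
      [:: true; true];
      [:: false; false; false];
      [:: true; false; false; true];
      [:: false; true; true; true; true];
      [:: true; true; false; true; false; true];
      [:: true; false; true; true; false; false; true];
      [:: false; true; true; true; true; false; false; true];
      [:: false; true; false; true; false; false; false; false; false]].

Definition single_pentagon0_cert : certificate :=
 ColourBy [:: 4; 4; 4; 3; 0; 4; 4; 4; 4; 1] [:: 0; 0; 3; 1; 3; 1; 1; 1; 1; 2; 2; 2; 2; 2; 3; 0; 3; 2; 2; 0; 3; 0].

Definition single_pentagon1 : seq (seq bool) :=
  [:: [::];
      [:: true];
      [:: true; true];
      [:: false; false; false];
      [:: true; false; false; true];
      [:: false; true; true; true; true];
      [:: true; true; false; true; false; true];
      [:: true; false; true; true; false; false; true];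
      [:: false; true; true; true; true; false; false; true];
      [:: false; true; false; true; false; false; false; true; false]].

Definition single_pentagon1_cert : certificate :=
 ColourBy [:: 4; 4; 4; 3; 0; 4; 4; 4; 4; 1] [:: 0; 3; 0; 3; 1; 3; 1; 1; 2; 2; 3; 2; 2; 2; 2; 2; 3; 3; 1; 0; 0].


Lemma double_pentagon_ok : certified double_pentagon double_pentagon_cert.
Proof. by vm_compute. Qed.

Lemma single_pentagon0_ok : certified single_pentagon0 single_pentagon0_cert.
Proof. by vm_compute. Qed.

Lemma single_pentagon1_ok : certified single_pentagon1 single_pentagon1_cert.
Proof. by vm_compute. Qed.

Lemma testbit_bits s j : N.testbit (bits s) (N.of_nat j) = nth false s j.
Proof.
elim: s j => [|b s IH] [|j] //.
  by case: b; rewrite /= ?N.succ_double_spec ?N.double_spec ?N.testbit_odd_0 ?N.testbit_even_0.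
rewrite [RHS]/= -IH Nat2N.inj_succ; case: b; rewrite [bits _]/=.
  by rewrite N.succ_double_spec N.testbit_odd_succ //; apply: N.le_0_l.
by rewrite N.double_spec N.testbit_even_succ //; apply: N.le_0_l.
Qed.

(** * Configurations located in a graph *)

Section Roots.
Variables (T : finType) (e : rel T).
Hypotheses (e_sym : symmetric e) (e_irr : irreflexive e).
Hypothesis avoids : forall kE g, kE \in forbidden -> ~ realizes e kE.1 (adj_in kE.2) g.

Definition lowers x0 (vs : seq T) : seq (seq bool) :=
  [seq [seq e (nth x0 vs k) (nth x0 vs j) | j <- iota 0 k] | k <- iota 0 (size vs)].

Definition labelling x0 (vs : seq T) (i : N) := nth x0 vs (N.to_nat i).

Lemma lowers_entry x0 vs i j : i < size vs -> j < i ->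
  entry (lowers x0 vs) i j = e (nth x0 vs i) (nth x0 vs j).
Proof.
move=> iv ji; rewrite /entry (nth_map 0) ?size_iota // nth_iota // (nth_map 0) ?size_iota //.
by rewrite nth_iota.
Qed.

Lemma lowers_neq x0 vs i j : twin_free (lowers x0 vs) -> i < size vs -> j < size vs ->
  i != j -> nth x0 vs i != nth x0 vs j.
Proof.
have szM : size (lowers x0 vs) = size vs by rewrite size_map size_iota.
have E k l : k < size vs -> l < size vs ->
    matrix_entry (lowers x0 vs) k l = e (nth x0 vs k) (nth x0 vs l).
  move=> kv lv; rewrite /matrix_entry.
  case: (ltngtP l k) => [lk|kl|->]; rewrite ?lowers_entry //.
rewrite /twin_free szM => /allP tw iv jv nij.
have := tw i; rewrite mem_iota => /(_ iv)/allP/(_ j); rewrite mem_iota => /(_ jv).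
rewrite (negPf nij) /=.
case/hasP=> l; rewrite mem_iota => lv; rewrite !E //.
by apply: contraNneq => ->.
Qed.

Lemma describes_row x0 vs k B : twin_free (lowers x0 vs) -> k < size vs ->
  unzip1 B = map N.of_nat (iota 0 k) ->
  describes e (labelling x0 vs) B (nth x0 vs k) (mk_row (nth [::] (lowers x0 vs) k)).
Proof.
move=> tw kv lB; rewrite describes_labels lB; apply/allP => _ /mapP[j + ->].
rewrite mem_iota => /= jk; rewrite !testbit_bits /labelling Nat2N.id.
have jv := ltn_trans jk kv.
have sz : size (nth [::] (lowers x0 vs) k) = k.
  by rewrite (nth_map 0) ?size_iota // nth_iota // size_map size_iota.
rewrite (nth_map false) ?sz // -/(entry (lowers x0 vs) k j) lowers_entry //.
rewrite (lowers_neq tw) // ?(gtn_eqF jk) //.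
by case: (e _ _).
Qed.

(** The vertices from position [k] on are labelled one at a time; [describes_row] shows that each
    matrix row fits its vertex, and [add_vertex] preserves the invariants. *)
Lemma foldl_grow x0 vs rows k B L : let f := labelling x0 vs in
  twin_free (lowers x0 vs) -> drop k (lowers x0 vs) = rows ->
  unzip1 B = map N.of_nat (iota 0 k) -> faithful e f B -> covers e f B L ->
  let BL := foldl grow (B, L) (map mk_row rows) in
  [/\ {subset unzip1 B <= unzip1 BL.1}, faithful e f BL.1 & covers e f BL.1 BL.2].
Proof.
move=> f tw; elim: rows k B L => [|r rows IH] k B L dk lB fB cB; first by split.
rewrite /=.
have kv : k < size vs.
  by have := congr1 size dk; rewrite size_drop /lowers size_map size_iota -subn_gt0 => ->.
have sB : size B = k by have := congr1 size lB; rewrite !size_map size_iota.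
have nl : next_label B = N.of_nat k by rewrite /next_label sB.
have nB : next_label B \notin unzip1 B.
  rewrite nl lB; apply/negP => /mapP[j]; rewrite mem_iota => /= jk /Nat2N.inj E.
  by rewrite E ltnn in jk.
have Er : r = nth [::] (lowers x0 vs) k by rewrite -[k in nth _ _ k]addn0 -nth_drop dk.
have lB' : unzip1 (add_base B (next_label B) (mk_row r)) = map N.of_nat (iota 0 k.+1).
  by rewrite labels_add_base lB nl -addn1 iotaD map_cat cats1.
have fk : f (next_label B) = nth x0 vs k by rewrite nl /f /labelling Nat2N.id.
have [fB' cB'] : faithful e f (add_base B (next_label B) (mk_row r)) /\
    covers e f (add_base B (next_label B) (mk_row r)) (add_types B L (next_label B) (mk_row r)).
  by apply: add_vertex => //; rewrite fk Er; apply: describes_row.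
have dk' : drop k.+1 (lowers x0 vs) = rows by rewrite -add1n -drop_drop dk /= drop0.
have [sub ? ?] := IH k.+1 _ _ dk' lB' fB' cB'; split=> // j jB.
by apply: sub; rewrite labels_add_base mem_rcons inE jB orbT.
Qed.

Lemma certified_col x0 vs M t : lowers x0 vs = M -> certified M t ->
  col e 4 (few e (labelling x0 vs)).
Proof.
move=> <- /and3P[tw /eqP t3]; set f := labelling x0 vs.
have sz : 2 < size vs.
  have := congr1 size t3; rewrite size_take size_map size_iota /=.
  by case: ltnP => [/ltnW|_ ->].
have E i j : i < 3 -> j < i -> e (nth x0 vs i) (nth x0 vs j).
  move=> i3 ji; rewrite -lowers_entry ?(leq_trans i3) // /entry.
  rewrite -(nth_take _ i3) t3.
  by case: i i3 ji => [|[|[|i]]] // _; case: j => [|[|j]].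
have e10 : e (f 1%num) (f 0%num) := E 1 0 isT isT.
have e20 : e (f 2%num) (f 0%num) := E 2 0 isT isT.
have e21 : e (f 2%num) (f 1%num) := E 2 1 isT isT.
have e01 := e10; have e02 := e20; have e12 := e21; rewrite e_sym in e01; rewrite e_sym in e02; rewrite e_sym in e12.
have lB : unzip1 triangle_base.1 = map N.of_nat (iota 0 3) by [].
have tB : triangle_base.1 = [:: (0%num, (6%num, 0%num)); (1%num, (5%num, 0%num)); (2%num, (3%num, 0%num))].
  by [].
have fB : faithful e f triangle_base.1.
  rewrite tB => i r; rewrite !inE => /or3P[] /eqP[-> ->];
    by rewrite describes_labels /= ?e01 ?e02 ?e12 ?e10 ?e20 ?e21.
have cB : covers e f triangle_base.1 triangle_base.2.
  move=> v; rewrite inE => vW out.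
  have n0 := out _ _ (mem_head _ _).
  exists (mk_row [:: e v (f 0%num); e v (f 1%num); e v (f 2%num)]).
    by move: vW; case: (e v _); case: (e v _); case: (e v _).
  rewrite describes_labels lB /=.
  have nf j : j \in unzip1 triangle_base.1 -> v != f j.
    by case/mapP => -[i r] iB ->; rewrite eq_sym; apply: (out _ _ iB).
  rewrite (nf 0%num) // (nf 1%num) // (nf 2%num) //.
  by case: (e v _); case: (e v _); case: (e v _).
rewrite [triangle_base]surjective_pairing /= => ok.
have [sub fB' cB'] := foldl_grow tw (erefl _) lB fB cB.
apply: check_col ok => // j j012; apply: sub; rewrite lB.
Qed.

End Roots.

(** * Pentagons in a neighbourhood *)

Section Pentagons.
Variables (T : finType) (e : rel T).
Hypotheses (e_sym : symmetric e) (e_irr : irreflexive e).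
Hypothesis P3P2 : P3P2free e.
Hypothesis k4 : K4free e.
Hypothesis coD : co_domino_free e.
Hypothesis coA : co_A_free e.
Hypothesis K3K2 : K3K2free e.
Hypothesis avoids : forall kE g, kE \in forbidden -> ~ realizes e kE.1 (adj_in kE.2) g.


Lemma C5_rot c1 c2 c3 c4 c5 : is_C5 e c1 c2 c3 c4 c5 -> is_C5 e c2 c3 c4 c5 c1.
Proof.
case/and5P=> ? ? ? ? /and5P[? ? ? ? /andP[? ?]].
by rewrite /is_C5; do ?[apply/andP; split]; rewrite // e_sym.
Qed.

Lemma C5_rev c1 c2 c3 c4 c5 : is_C5 e c1 c2 c3 c4 c5 -> is_C5 e c1 c5 c4 c3 c2.
Proof.
case/and5P=> ? ? ? ? /and5P[? ? ? ? /andP[? ?]].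
by rewrite /is_C5; do ?[apply/andP; split]; rewrite // e_sym.
Qed.

Definition away a b c x := triangle e a b c /\ misses e x a b c.

Lemma away_rot a b c x : away a b c x -> away b c a x.
Proof. by case=> t m; split; [apply: triangle_rot | apply: misses_rot]. Qed.

Lemma away_swap a b c x : away a b c x -> away b a c x.
Proof.
case=> /and3P[? ? ?] /and3P[? ? ?].
by split; apply/and3P; split=> //; rewrite e_sym.
Qed.

Definition at_most_one a b c : {set T} := [set v | e v a + e v b + e v c <= 1].

Definition single a b c v := e v a + e v b + e v c == 1.

Lemma nbr_meets a b c x v : away a b c x -> e x v -> ~~ misses e v a b c.
Proof. by case=> t m xv; apply/negP => mv; apply: (K3K2 t xv). Qed.

Lemma nbr_not_all a b c x v : away a b c x -> ~~ [&& e v a, e v b & e v c].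
Proof.
case=> /and3P[ab bc ac] _; apply/negP => /and3P[va vb vc].
exact: (k4 va vb vc ab ac bc).
Qed.

Lemma common_pair a b c x u v : away a b c x -> e u v -> e u a -> e u b -> e v a -> ~~ e v b.
Proof.
case=> /and3P[ab _ _] _ uv ua ub va; apply/negP => vb; exact: (k4 uv ua ub va vb ab).
Qed.

(** The vertex [w] sees some but not all of the triangle. Seeing [a] and one more gives a co-A, [a]
    alone makes the triangle [x v w] anticomplete to [bc], and [b] or [c] alone gives a
    co-domino. *)
Lemma single_nbr a b c x v w : away a b c x -> e x v -> e x w -> e v w ->
  e v a -> ~~ e v b -> ~~ e v c -> [/\ ~~ e w a, e w b & e w c].
Proof.
move=> aw xv xw vw va vb vc; have [/and3P[ab bc ac] /and3P[xa xb xc]] := aw.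
have vx : e v x by rewrite e_sym.
have wx : e w x by rewrite e_sym.
have ba : e b a by rewrite e_sym.
have ca : e c a by rewrite e_sym.
have cb : e c b by rewrite e_sym.
have wv : e w v by rewrite e_sym.
have av : e a v by rewrite e_sym.
have bv : ~~ e b v by rewrite e_sym.
have cv : ~~ e c v by rewrite e_sym.
have ax : ~~ e a x by rewrite e_sym.
have bx : ~~ e b x by rewrite e_sym.
have cx : ~~ e c x by rewrite e_sym.
have := nbr_meets aw xw; have := nbr_not_all w aw; rewrite /misses.
case wa: (e w a); case wb: (e w b); case wc: (e w c) => // _ _; exfalso.
- apply: (coA (u1 := w) (v1 := b) (v2 := c) (v3 := a) (u3 := v) (u2 := x)); rewrite ?wa ?wb ?wc //.
- apply: (coA (u1 := w) (v1 := c) (v2 := b) (v3 := a) (u3 := v) (u2 := x)); rewrite ?wa ?wb ?wc //.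
- apply: (K3K2 (a := x) (b := v) (c := w) _ bc); last 2 first.
  + by apply/and3P; split; rewrite // e_sym wb.
  + by apply/and3P; split; rewrite // e_sym wc.
  by apply/and3P.
- have bw : e b w by rewrite e_sym.
  apply: (coD (u1 := v) (v1 := a) (v2 := c) (v3 := b) (u3 := w) (u2 := x)); rewrite ?wa ?wb ?wc //.
    by rewrite e_sym wa.
  by rewrite e_sym wc.
- have cw : e c w by rewrite e_sym.
  apply: (coD (u1 := v) (v1 := a) (v2 := b) (v3 := c) (u3 := w) (u2 := x)); rewrite ?wa ?wb ?wc //.
    by rewrite e_sym wa.
  by rewrite e_sym wb.
Qed.

(** Two such vertices are non-adjacent by [single_nbr], and then the path [u x v] is anticomplete to
    [bc]. *)
Lemma single_uniq a b c x u v : away a b c x -> e x u -> e x v ->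
  e u a -> ~~ e u b -> ~~ e u c -> e v a -> ~~ e v b -> ~~ e v c -> u = v.
Proof.
move=> aw xu xv ua ub uc va vb vc; apply/eqP/contraT => nuv.
have [/and3P[ab bc ac] /and3P[xa xb xc]] := aw.
have [uv|nuv'] := boolP (e u v).
  by have [] := single_nbr aw xu xv uv ua ub uc; rewrite va.
have ux : e u x by rewrite e_sym.
by case: (P3P2 ux xv nuv nuv' bc).
Qed.

Lemma few_at_most_one a b c vs x0 : nth x0 vs 0 = a -> nth x0 vs 1 = b -> nth x0 vs 2 = c ->
  col e 4 (few e (labelling x0 vs)) -> col e 4 (at_most_one a b c).
Proof. by move=> <- <- <-; apply: col_sub; apply/subsetP => v; rewrite !inE. Qed.

Lemma at_most_one_perm a b c a' b' c' : perm_eq [:: a; b; c] [:: a'; b'; c'] ->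
  at_most_one a b c = at_most_one a' b' c'.
Proof.
move=> pe; apply/setP => v; rewrite !inE.
have : \sum_(t <- [:: a; b; c]) e v t = \sum_(t <- [:: a'; b'; c']) e v t by apply: perm_big.
by rewrite !big_cons !big_nil !addn0 -!addnA => ->.
Qed.

Lemma C5_edges c1 c2 c3 c4 c5 : is_C5 e c1 c2 c3 c4 c5 ->
  [/\ e c2 c1 = true, e c3 c2 = true, e c4 c3 = true, e c5 c4 = true & e c5 c1 = true] /\
  [/\ e c3 c1 = false, e c4 c2 = false, e c5 c3 = false, e c4 c1 = false & e c5 c2 = false].
Proof.
case/and5P=> ? ? ? ? /and5P[? ? ? ? /andP[? ?]].
by split; split=> //; first [exact/negbTE | by rewrite e_sym | by rewrite e_sym; apply/negbTE].
Qed.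

Lemma double_pentagon_core a b c x c1 c2 c3 c4 c5 : away a b c x -> is_C5 e c1 c2 c3 c4 c5 ->
  [&& e x c1, e x c2, e x c3, e x c4 & e x c5] ->
  [/\ e c1 a = true, e c1 b = true & e c1 c = false] ->
  [/\ e c2 a = true, e c2 b = false & e c2 c = true] ->
  [/\ e c3 a = true, e c3 b = true & e c3 c = false] ->
  [/\ e c4 a = true, e c4 b = false & e c4 c = true] ->
  [/\ e c5 a = false, e c5 b = true & e c5 c = true] ->
  col e 4 (at_most_one a b c).
Proof.
move=> [/and3P[ab bc ac] /and3P[/negbTE xa /negbTE xb /negbTE xc]] /C5_edges[[s21 s32 s43 s54 s51]
  [s31 s42 s53 s41 s52]] /and5P[x1 x2 x3 x4 x5] [? ? ?] [? ? ?] [? ? ?] [? ? ?] [? ? ?].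
rewrite e_sym in ab; rewrite e_sym in bc; rewrite e_sym in ac.
rewrite e_sym in x1; rewrite e_sym in x2; rewrite e_sym in x3; rewrite e_sym in x4; rewrite e_sym in x5.
apply: (@few_at_most_one _ _ _ [:: a; b; c; x; c1; c2; c3; c4; c5] a) => //.
apply: certified_col double_pentagon_ok => //.
rewrite /lowers /=; by do !congr (_ :: _).
Qed.

Lemma single_pentagon_core a b c x c1 c2 c3 c4 c5 y : away a b c x -> is_C5 e c1 c2 c3 c4 c5 ->
  [&& e x c1, e x c2, e x c3, e x c4 & e x c5] -> e x y ->
  [/\ e c1 a = true, e c1 b = false & e c1 c = false] ->
  [/\ e c2 a = false, e c2 b = true & e c2 c = true] ->
  [/\ e c3 a = true, e c3 b = true & e c3 c = false] ->
  [/\ e c4 a = true, e c4 b = false & e c4 c = true] ->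
  [/\ e c5 a = false, e c5 b = true & e c5 c = true] ->
  [/\ e y a = false, e y b = true & e y c = false] ->
  col e 4 (at_most_one a b c).
Proof.
move=> aw pent xs xy t1 t2 t3 t4 t5 ty.
have [/and3P[ab bc ac] /and3P[/negbTE xa /negbTE xb /negbTE xc]] := aw.
have [[s21 s32 s43 s54 s51] [s31 s42 s53 s41 s52]] := C5_edges pent.
case/and5P: xs => x1 x2 x3 x4 x5; case: t1 t2 t3 t4 t5 ty => t1a t1b t1c [t2a t2b t2c]
 [t3a t3b t3c] [t4a t4b t4c] [t5a t5b t5c] [tya tyb tyc].
(* By [single_nbr] at [b], a neighbour of [y] in N(x) sees both [a] and [c]; on the pentagon only
   [c4] does. *)
have yP w : e x w -> ~~ (e w a && e w c) -> e y w = false.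
  move=> xw; apply: contraNF => yw.
  have := single_nbr (away_rot aw) xy xw yw tyb; rewrite tya tyc => -[] // _ -> ->.
  by [].
have y1 := yP c1 x1; have y2 := yP c2 x2; have y3 := yP c3 x3; have y5 := yP c5 x5.
rewrite t1a t1c in y1; rewrite t2a t2c in y2; rewrite t3a t3c in y3; rewrite t5a t5c in y5.
have {}y1 := y1 isT; have {}y2 := y2 isT; have {}y3 := y3 isT; have {}y5 := y5 isT.
rewrite e_sym in ab; rewrite e_sym in bc; rewrite e_sym in ac; rewrite e_sym in xy.
rewrite e_sym in x1; rewrite e_sym in x2; rewrite e_sym in x3; rewrite e_sym in x4; rewrite e_sym in x5.
apply: (@few_at_most_one _ _ _ [:: a; b; c; x; c1; c2; c3; c4; c5; y] a) => //.
(* This is the only adjacency of the configuration left undetermined; each value has its own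
   certificate. *)
case y4 : (e y c4).
  apply: certified_col single_pentagon1_ok => //.
  rewrite /lowers /=; by do !congr (_ :: _).
apply: certified_col single_pentagon0_ok => //.
rewrite /lowers /=; by do !congr (_ :: _).
Qed.


Lemma away_perm a b c x i j l : away a b c x ->
  i < 3 -> j < 3 -> l < 3 -> i != j -> j != l -> i != l ->
  let t := nth a [:: a; b; c] in
  away (t i) (t j) (t l) x /\ at_most_one (t i) (t j) (t l) = at_most_one a b c.
Proof.
move=> aw i3 j3 l3 nij njl nil t.
have P : perm_eq [:: t i; t j; t l] [:: a; b; c].
  have : perm_eq [:: i; j; l] [:: 0; 1; 2].
    by case: i i3 nij nil => [|[|[|i]]] //; case: j j3 njl => [|[|[|j]]] //; case: l l3 => [|[|[|l]]].
  by move/(perm_map t).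
split; last exact: at_most_one_perm.
have aw1 := away_rot aw; have aw2 := away_rot aw1.
have aw3 := away_swap aw; have aw4 := away_swap aw1; have aw5 := away_swap aw2.
rewrite {P} /t {t}; case: i i3 nij nil => [|[|[|i]]] //; case: j j3 njl => [|[|[|j]]] //;
  by case: l l3 => [|[|[|l]]].
Qed.

(** A proper 3-colouring of a pentagon uses one colour once and the other two twice, alternating on
    the remaining four vertices. *)
Lemma three_coloured_C5 i1 i2 i3 i4 i5 : i1 < 3 -> i2 < 3 -> i3 < 3 -> i4 < 3 -> i5 < 3 ->
  i1 != i2 -> i2 != i3 -> i3 != i4 -> i4 != i5 -> i5 != i1 ->
  (i1 == i3) && (i2 == i4) || (i2 == i4) && (i3 == i5) || (i3 == i5) && (i4 == i1) ||
  (i4 == i1) && (i5 == i2) || (i5 == i2) && (i1 == i3).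
Proof.
by case: i1 => [|[|[|?]]] //; case: i2 => [|[|[|?]]] //; case: i3 => [|[|[|?]]] //;
   case: i4 => [|[|[|?]]] //; case: i5 => [|[|[|?]]].
Qed.

Lemma double_pentagon_col a b c x c1 c2 c3 c4 c5 : away a b c x -> is_C5 e c1 c2 c3 c4 c5 ->
  [&& e x c1, e x c2, e x c3, e x c4 & e x c5] ->
  ~~ has (single a b c) [:: c1; c2; c3; c4; c5] -> col e 4 (at_most_one a b c).
Proof.
move=> aw pent xs ns.
(* [k v] is the position of the triangle vertex missed by [v]. It properly colours the pentagon,
   since adjacent vertices missing the same one form a [K4] with the other two. *)
pose k v := if ~~ e v a then 0 else if ~~ e v b then 1 else 2.
have k3 v : k v < 3 by rewrite /k; do 2![case: ifP => //].
have kP v i : e x v -> ~~ single a b c v -> i < 3 -> e v (nth a [:: a; b; c] i) = (k v != i).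
  move=> xv nv i3; move: nv (nbr_meets aw xv) (nbr_not_all v aw); rewrite /single /misses /k.
  by case: i i3 => [|[|[|i]]] //= _; case: (e v a); case: (e v b); case: (e v c).
have kN u v : e x u -> e x v -> ~~ single a b c u -> ~~ single a b c v -> e u v -> k u != k v.
  move=> xu xv su sv uv; apply/eqP => E.
  have [i [j [i3 j3]]] : exists i j, [/\ i < 3, j < 3, i != j, j != k u & i != k u].
    by have := k3 u; case: (k u) => [|[|[|m]]] // _; [exists 1, 2|exists 0, 2|exists 0, 1].
  move=> nij nj ni; have [aw' _] := away_perm aw i3 j3 (k3 u) nij nj ni.
  have := common_pair aw' uv; rewrite !kP // -!E ![k u == _]eq_sym ni nj.
  by move=> /(_ isT isT isT).
wlog : c1 c2 c3 c4 c5 pent xs ns / (k c1 == k c3) && (k c2 == k c4).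
  move=> W; move: (xs) (ns) => /and5P[x1 x2 x3 x4 x5]; rewrite /= !negb_or andbT.
  case/and5P=> n1 n2 n3 n4 n5; have /and5P[e12 e23 e34 e45 /andP[e51 _]] := pent.
  have p2 := C5_rot pent; have p3 := C5_rot p2; have p4 := C5_rot p3; have p5 := C5_rot p4.
  have := three_coloured_C5 (k3 c1) (k3 c2) (k3 c3) (k3 c4) (k3 c5) (kN _ _ x1 x2 n1 n2 e12)
    (kN _ _ x2 x3 n2 n3 e23) (kN _ _ x3 x4 n3 n4 e34) (kN _ _ x4 x5 n4 n5 e45) (kN _ _ x5 x1 n5 n1 e51).
  case/orP=> [/orP[/orP[/orP[]|]|]|]; [apply: W pent _ _|apply: W p2 _ _|apply: W p3 _ _|
    apply: W p4 _ _|apply: W p5 _ _];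
    by rewrite /= ?x1 ?x2 ?x3 ?x4 ?x5 ?(negPf n1) ?(negPf n2) ?(negPf n3) ?(negPf n4) ?(negPf n5).
case/andP=> /eqP k13 /eqP k24; move: (xs) ns => /and5P[x1 x2 x3 x4 x5]; rewrite /= !negb_or andbT.
case/and5P=> n1 n2 n3 n4 n5; have /and5P[e12 e23 e34 e45 /andP[e51 _]] := pent.
have n12 := kN _ _ x1 x2 n1 n2 e12; have n45 := kN _ _ x4 x5 n4 n5 e45.
have n51 := kN _ _ x5 x1 n5 n1 e51; rewrite -k24 in n45.
have n52 : k c5 != k c2 by rewrite eq_sym.
have n21 : k c2 != k c1 by rewrite eq_sym.
have n15 : k c1 != k c5 by rewrite eq_sym.
(* The triangle vertices missed by [c5], [c2], [c1] take the places of [a], [b], [c] in the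
   configuration. *)
have [aw' <-] := away_perm aw (k3 c5) (k3 c2) (k3 c1) n52 n21 n51.
apply: double_pentagon_core aw' pent xs _ _ _ _ _; rewrite !kP // -?k13 -?k24 ?eqxx;
  by rewrite ?n12 ?n21 ?n15 ?n51 ?n45 ?n52.
Qed.

Lemma single_pentagon_col a b c x c1 c2 c3 c4 c5 y : away a b c x -> is_C5 e c1 c2 c3 c4 c5 ->
  [&& e x c1, e x c2, e x c3, e x c4 & e x c5] -> e x y -> y != c1 ->
  single a b c c1 -> single a b c y -> col e 4 (at_most_one a b c).
Proof.
wlog t1 : a b c / [/\ e c1 a, ~~ e c1 b & ~~ e c1 c].
  move=> W aw pent xs xy nyc s1 sy; have aw' := away_rot aw; have aw'' := away_rot aw'.
  have := s1; rewrite /single; case E1: (e c1 a); case E2: (e c1 b); case E3: (e c1 c) => // _.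
  - by apply: (W a b c) => //; rewrite E1 E2 E3.
  - rewrite (@at_most_one_perm a b c b c a); last by rewrite perm_sym (perm_rot 1 [:: a; b; c]).
    have sE v : single b c a v = single a b c v by rewrite /single addnC addnA.
    by apply: (W b c a) => //; rewrite ?sE // E1 E2 E3.
  - rewrite (@at_most_one_perm a b c c a b); last by rewrite perm_sym (perm_rot 2 [:: a; b; c]).
    have sE v : single c a b v = single a b c v by rewrite /single -addnA addnC.
    by apply: (W c a b) => //; rewrite ?sE // E1 E2 E3.
move=> aw; have [/and3P[ab bc ac] _] := aw; case: t1 => t1a t1b t1c.
have swap : away a c b x by exact: away_rot (away_swap aw).
have swapE : at_most_one a b c = at_most_one a c b.
  by apply: at_most_one_perm; rewrite perm_cons (perm_catC [:: b] [:: c]).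
(* By [single_uniq] the neighbour of [y] on the triangle is not [a]; exchanging [b] and [c] makes it
   [b]. *)
wlog ty : b c aw swap swapE ab bc ac t1b t1c / [/\ e y a = false, e y b = true & e y c = false].
  move=> W pent xs xy nyc s1 sy; have x1 : e x c1 by case/and5P: xs.
  have := sy; rewrite /single; case E1: (e y a); case E2: (e y b); case E3: (e y c) => // _.
  - case/eqP: nyc; apply: (single_uniq aw xy x1); by rewrite ?E1 ?E2 ?E3.
  - by apply: (W b c).
  rewrite swapE; apply: (W c b) => //; rewrite ?E1 ?E2 ?E3 //; first by rewrite e_sym.
    by move: s1; rewrite /single addnAC.
  by move: sy; rewrite /single addnAC.
move=> pent xs xy nyc s1 sy.
(* The vertices [c3] and [c4] both see [a] and see different ones of [b], [c]; reversing the cycle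
   fixes which. *)
wlog t3 : c2 c3 c4 c5 pent xs / [/\ e c3 a = true, e c3 b = true & e c3 c = false] /\
   [/\ e c4 a = true, e c4 b = false & e c4 c = true].
  move=> W; have /and5P[x1 x2 x3 x4 x5] := xs.
  have /and5P[e12 e23 e34 e45 /and5P[e51 n13 n24 n35 /andP[n41 n52]]] := pent.
  have bic w : e x w -> e c1 w -> [/\ ~~ e w a, e w b & e w c].
    by move=> xw c1w; apply: (single_nbr aw x1 xw c1w t1a t1b t1c).
  have e15 : e c1 c5 by rewrite e_sym.
  have [n2a b2 c2'] := bic c2 x2 e12; have [n5a b5 c5'] := bic c5 x5 e15.
  have e54 : e c5 c4 by rewrite e_sym.
  (* As [w] sees [b] and [c], [u] cannot see both, by [K4]. [single_uniq] excludes that [u] sees [a]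
     alone, and [single_nbr] excludes [b] or [c] alone. *)
  have dbl u w : e x u -> e x w -> e u w -> u != c1 -> ~~ e w a -> e w b -> e w c -> e u a && (e u b (+) e u c).
    move=> xu xw uw nu wa wb wc.
    have meets := nbr_meets aw xu; have nall := nbr_not_all u aw.
    have ncp := common_pair (away_rot aw) uw; rewrite wc in ncp.
    move: meets nall; rewrite /misses.
    case ua: (e u a); case ub: (e u b); case uc: (e u c) => //= _ _.
    - by case/eqP: nu; apply: (single_uniq aw xu x1); rewrite ?ua ?ub ?uc.
    - by have := ncp ub uc wb.
    - have := single_nbr (away_rot aw) xu xw uw ub; rewrite uc ua => -[] // _; by rewrite (negPf wa).
    - have := single_nbr (away_rot (away_rot aw)) xu xw uw uc; rewrite ua ub => -[] //; by rewrite (negPf wa).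
  have n3 : c3 != c1 by apply: (adj_neq e34); rewrite e_sym.
  have n4 : c4 != c1 by apply: (@adj_neq _ e _ _ c3); rewrite 1?e_sym // e_sym.
  have e32 : e c3 c2 by rewrite e_sym.
  have e43 : e c4 c3 by rewrite e_sym.
  have /andP[a3 d3] := dbl c3 c2 x3 x2 e32 n3 n2a b2 c2'.
  have /andP[a4 d4] := dbl c4 c5 x4 x5 e45 n4 n5a b5 c5'.
  have nab := common_pair aw e34 a3; have nac := common_pair swap e34 a3.
  case b3: (e c3 b) d3 nab nac; case c3': (e c3 c) => //= _ nab nac.
    have nb4 := nab isT a4; apply: (W c2 c3 c4 c5) => //.
    by move: d4; rewrite (negPf nb4) a3 b3 c3' a4 => /= ->.
  have nc4 := nac isT a4; apply: (W c5 c4 c3 c2); first exact: C5_rev.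
    by rewrite x1 x2 x3 x4 x5.
  by move: d4; rewrite (negPf nc4) addbF a3 b3 c3' a4 => ->.
have [t3' t4'] := t3; have /and5P[x1 x2 x3 x4 x5] := xs.
have /and5P[e12 _ _ _ /andP[e51 _]] := pent.
have bic w : e x w -> e c1 w -> [/\ e w a = false, e w b = true & e w c = true].
  by move=> xw c1w; have [/negPf-> -> ->] := single_nbr aw x1 xw c1w t1a t1b t1c.
apply: single_pentagon_core aw pent xs xy _ (bic _ x2 e12) t3' t4' _ ty.
  by split=> //; apply/negbTE.
by apply: bic; rewrite // e_sym.
Qed.

End Pentagons.

(** * Assembly of the seven colours *)

Section Main.
Variables (T : finType) (e : rel T).
Hypotheses (e_sym : symmetric e) (e_irr : irreflexive e).
Hypotheses (hP : free e P3uP2) (hK : free e K4) (hD : free e co_domino) (hA : free e co_A).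

Let P3P2 := P3P2free_of_free e_sym e_irr hP.
Let k4 := K4free_of_free e_sym e_irr hK.

Lemma C5_or_col7 x y z : K3K2free e ->
  e x y -> e x z ->
  col e 7 [set: T] \/ exists c1 c2 c3 c4 c5,
    [/\ is_C5 e c1 c2 c3 c4 c5, [&& e x c1, e x c2, e x c3, e x c4 & e x c5] &
        [&& c1 != z, c2 != z, c3 != z, c4 != z & c5 != z]].
Proof.
move=> K3K2 xy xz.
have tf : triangle_free e (nbhd e x :\ z).
  move=> a b c /setD1P[_ aN] /setD1P[_ bN] /setD1P[_ cN]; exact: (triangle_free_nbhd k4 aN bN cN).
case: (col2_or_C5 e_sym P3P2 tf) => [c2|]; last first.
  move=> [c1 [c2 [c3 [c4 [c5 [/and5P[]]]]]]]; rewrite !inE.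
  move=> /andP[n1 x1] /andP[n2 x2] /andP[n3 x3] /andP[n4 x4] /andP[n5 x5] pent.
  by right; exists c1, c2, c3, c4, c5; split=> //; apply/and5P.
left.
have [/existsP[u /andP[xu uz]]|nz] := boolP [exists u, e x u && e u z].
  exact: (col7_bipartite_nbhd e_sym e_irr P3P2 k4 K3K2 xu xz uz).
(* Here [z] is isolated in N(x), so all of N(x) is two-colourable; any edge inside N(x) can replace
   the missing [uz], and without one N(x) is stable. *)
have c2N : col e 2 (nbhd e x).
  apply: (@col_sub _ e 2 _ (z |: (nbhd e x :\ z))).
    by apply/subsetP => v; rewrite !inE; case: eqP.
  apply: col_isolated => // v; rewrite !inE => /andP[_ xv]; apply: contra nz => zv.
  by apply/existsP; exists v; rewrite xv e_sym.
have [/existsP[u /existsP[v /and3P[xu xv uv]]]|st] := boolP [exists u, exists v, [&& e x u, e x v & e u v]].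
  apply: (col7_bipartite_nbhd e_sym e_irr P3P2 k4 K3K2 xu xv uv).
  by apply: col_sub c2N; apply: subD1set.
apply: (col7_stable_nbhd e_sym e_irr P3P2 k4 K3K2 xy) => v w xv xw.
by apply: contra st => vw; apply/existsP; exists v; apply/existsP; exists w; apply/and3P.
Qed.

Lemma avoids_forbidden : K3K2free e ->
  forall kE (g : nat -> T), kE \in forbidden -> ~ realizes e kE.1 (adj_in kE.2) g.
Proof.
move=> K3K2 kE g; rewrite !inE => /orP[/eqP->|/orP[/eqP->|/orP[/eqP->|/orP[/eqP->|/eqP->]]]].
- exact: free_realizes.
- move=> H; have h i j : i < 5 -> j < 5 -> i != j -> e (g i) (g j) = adj_in K3K2_edges i j.
    by move=> i5 j5 nij; have [] := H i j i5 j5 nij.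
  apply: (K3K2 (g 0) (g 1) (g 2) (g 3) (g 4)); rewrite /triangle /misses !h //.
- move=> H; have h i j : i < 4 -> j < 4 -> i != j -> e (g i) (g j).
    move=> i4 j4 nij; have [-> _] := H i j i4 j4 nij.
    by case: i i4 nij => [|[|[|[|i]]]] //; case: j j4 => [|[|[|[|j]]]].
  by apply: (k4 (a := g 0) (b := g 1) (c := g 2) (d := g 3)); apply: h.
- exact: free_realizes.
- exact: free_realizes.
Qed.

Lemma col7_main : col e 7 [set: T].
Proof.
have [ex|no] := boolP [exists a, exists b, exists c, exists x, exists y,
    [&& triangle e a b c, e x y, misses e x a b c & misses e y a b c]].
  case/existsP: ex => a /existsP[b /existsP[c /existsP[x /existsP[y /and4P[t xy mx my]]]]].
  exact: (col7_triangle_edge e_sym e_irr P3P2 k4 t xy mx my).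
have K3K2 : K3K2free e.
  move=> a b c x y t xy mx my; case/negP: no; apply/existsP; exists a; apply/existsP; exists b.
  by apply/existsP; exists c; apply/existsP; exists x; apply/existsP; exists y; apply/and4P.
have [ex|{}no] := boolP [exists x, exists y, exists a, exists b, exists c,
    [&& e x y, triangle e a b c & misses e x a b c]]; last first.
  apply: (col7_no_isolated_miss e_sym e_irr P3P2 k4 K3K2) => x y a b c xy t m.
  case/negP: no; apply/existsP; exists x; apply/existsP; exists y; apply/existsP; exists a.
  by apply/existsP; exists b; apply/existsP; exists c; apply/and3P.
case/existsP: ex => x /existsP[y /existsP[a /existsP[b /existsP[c /and3P[xy t m]]]]].
have aw : away e a b c x by [].
have av := avoids_forbidden K3K2.
have coD := co_domino_free_of_free e_sym e_irr hD.
have coA := co_A_free_of_free e_sym e_irr hA.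
suff [//|c4] : col e 7 [set: T] \/ col e 4 (at_most_one e a b c).
  have /and3P[ab bc ac] := t.
  apply: col_sub (colU c4 (colU (col1_common_nbhd k4 ab) (colU (col1_common_nbhd k4 bc) (col1_common_nbhd k4 ac)))).
  by apply/subsetP => v _; rewrite !inE; case: (e v a); case: (e v b); case: (e v c).
have dbl := double_pentagon_col e_sym e_irr k4 K3K2 av aw.
have sgl c1 c2 c3 c4 c5 z : is_C5 e c1 c2 c3 c4 c5 ->
    [&& e x c1, e x c2, e x c3, e x c4 & e x c5] -> e x z -> z != c1 -> single e a b c c1 ->
    single e a b c z -> col e 4 (at_most_one e a b c).
  exact: (single_pentagon_col e_sym e_irr P3P2 k4 coD coA K3K2 av aw).
(* A pentagon avoiding the singly attached [z] either has no singly attached vertex or supplies a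
   second one, to which it is rotated. *)
have find z : e x z -> single e a b c z -> col e 7 [set: T] \/ col e 4 (at_most_one e a b c).
  move=> xz sz; case: (C5_or_col7 K3K2 xy xz) => [|[c1 [c2 [c3 [c4 [c5 [pent xs nz]]]]]]]; first by left.
  right; have [|ns] := boolP (has (single e a b c) [:: c1; c2; c3; c4; c5]); last exact: dbl pent xs ns.
  have p2 := C5_rot pent; have p3 := C5_rot p2; have p4 := C5_rot p3.
  have p5 := C5_rot p4; have /and5P[x1 x2 x3 x4 x5] := xs.
  move: nz; rewrite ![_ == z]eq_sym => /and5P[n1 n2 n3 n4 n5].
  rewrite /= orbF => /orP[s|/orP[s|/orP[s|/orP[s|s]]]];
    [apply: (sgl _ _ _ _ _ _ pent _ xz n1 s sz)|apply: (sgl _ _ _ _ _ _ p2 _ xz n2 s sz)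
    |apply: (sgl _ _ _ _ _ _ p3 _ xz n3 s sz)|apply: (sgl _ _ _ _ _ _ p4 _ xz n4 s sz)
    |apply: (sgl _ _ _ _ _ _ p5 _ xz n5 s sz)]; by rewrite ?x1 ?x2 ?x3 ?x4 ?x5.
(* Any neighbour of [x] may be deleted here, such as [y]. If the pentagon obtained has a singly
   attached vertex, that vertex is passed to [find]. *)
case: (C5_or_col7 K3K2 xy xy) => [|[c1 [c2 [c3 [c4 [c5 [pent xs _]]]]]]]; first by left.
have [/hasP[z]|ns] := boolP (has (single e a b c) [:: c1; c2; c3; c4; c5]); last first.
  right; exact: dbl pent xs ns.
have /and5P[x1 x2 x3 x4 x5] := xs.
by rewrite !inE => /orP[/eqP->|/orP[/eqP->|/orP[/eqP->|/orP[/eqP->|/eqP->]]]]; apply: find.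
Qed.

End Main.

Theorem theorem1p3 (T : finType) (e : rel T)
  (e_sym : symmetric e) (e_irr : irreflexive e)
  (hP : free e P3uP2) (hK : free e K4)
  (hD : free e co_domino) (hA : free e co_A)
  (h2 : ~ induced_iso_sub_K3 e (D2 e)) :
  colorable e 7.
Proof. by apply: col_colorable; apply: col7_main. Qed.
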